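(* Assume that every definable subset of $K$ that is closed, bounded and discrete is finite. Let $\tau$ be a non-zero and non-invertible element of $\mathcal O$ (i.e. $\tau\in\mathcal O\setminus\{0\}$ and $\tau^{-1}\notin\mathcal O$). Let $X\subseteq K^m$ be a definable set which has arbitrarily many germs at some point $p_0\in X$. (i) If $\mathcal O=[-1,1]$ (the ordered case), then the ring of functions $f\in\mathcal C(X)$ such that $f(p_0)\in\mathbb Z$ is definable in $(\mathcal C(X),\mathcal B)$. (ii) In any case (ordered or valued), the set of functions $f\in\mathcal C(X)$ such that $f(p_0)\in\tau^{\mathbb Z}$ is definable in $(\mathcal C(X),\mathcal B)$, and its natural ring structure is interpretable in $(\mathcal C(X),\mathcal B)$. As a consequence, the ring of integers $\mathbb Z$ is interpretable in $(\mathcal C(X),\mathcal B)$.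
   Context: Setting. $K$ is a field and $\mathcal O\subseteq K$ is either (ordered case) the unit interval $[-1,1]$ of a total order $\le$ making $K$ an ordered field, or (valued case) the valuation ring of a non-trivial valuation $v$ on $K$. $\mathcal K$ is an expansion of $(K,\mathcal O)$: a structure with universe $K$ in a language extending the ring language $\{0,1,+,-,\times\}$ together with a unary predicate for $\mathcal O$. ''Definable'' means first-order definable with parameters (in $\mathcal K$ for subsets of $K^m$). $\mathcal O^\times$ is the set of non-zero $a\in\mathcal O$ with $a^{-1}\in\mathcal O$; $|x|$ is the class of $x\in K^\times$ in $K^\times/\mathcal O^\times$, $|0|=0$, and $|y|\le|x|$ iff $y\in x\mathcal O$ (the usual absolute value in the ordered case, the multiplicatively written valuation in the valued case). For $x\in K^m$, $\|x\|=\max_i|x_i|$; $K^m$ carries the topology given by the open balls for $\|\cdot\|$; ''bounded'' is with respect to $\|\cdot\|$. For a definable set $X\subseteq K^m$, $\mathcal C(X)$ is the ring (with pointwise operations) of continuous definable functions $X\to K$, and $\mathcal B=\{s\in\mathcal C(X): s(x)\in\mathcal O\text{ for all }x\in X\}$. $(\mathcal C(X),\mathcal B)$ is the ring $\mathcal C(X)$ expanded by a unary predicate for $\mathcal B$. Germs. Let $p_0\in X$ and let $U$ be a definable neighborhood of $p_0$ in $X$. A function $s\in\mathcal C(U)$ vanishes on a germ at $p_0$ if $s(p_0)=0$ and $p_0$ is not an isolated point of the zero set $\{s=0\}$. Functions $s_1,\dots,s_k\in\mathcal C(U)$ vanish on separated germs at $p_0$ if there are $\delta_1,\dots,\delta_k\in\mathcal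 C(U\setminus\{p_0\})$ such that: (S1) the sets $S_i=\{s_i=0\}\setminus\{p_0\}$ are pairwise disjoint; (S2) each $s_i$ vanishes on a germ at $p_0$; (S3) for $i\ne j$, $\delta_i$ is constantly $1$ on $S_i$ and constantly $0$ on $S_j$; (S4) each $\delta_i$ is bounded on $U\setminus\{p_0\}$. $X$ has arbitrarily many germs at $p_0$ if for every positive integer $k$ there are a definable neighborhood $U$ of $p_0$ in $X$ and $k$ functions in $\mathcal C(U)$ that vanish on separated germs at $p_0$. $\tau^{\mathbb Z}=\{\tau^k:k\in\mathbb Z\}$, furnished with the ring structure for which $k\mapsto\tau^k$ is a ring isomorphism $\mathbb Z\to\tau^{\mathbb Z}$. The natural ring structure in (ii) is the one induced by that of $\tau^{\mathbb Z}$ via $f\mapsto f(p_0)$, functions $f,g$ being identified when $f(p_0)=g(p_0)$. *)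

(* Defs.v *)
From HB Require Import structures.
From mathcomp Require Import all_boot all_order all_algebra.
From mathcomp Require Import mathcomp_extra boolp classical_sets functions
  cardinality.
From mathcomp Require Import ring lra.

Set Implicit Arguments.
Unset Strict Implicit.
Unset Printing Implicit Defensive.

Import Order.TTheory GRing.Theory Num.Theory.

Local Open Scope classical_set_scope.
Local Open Scope ring_scope.

Record language := Language {
  fsym : Type; farity : fsym -> nat;
  rsym : Type; rarity : rsym -> nat }.

Record structure (L : language) (T : Type) := Structure {
  fint : forall f : fsym L, ('I_(farity f) -> T) -> T;
  rint : forall r : rsym L, ('I_(rarity r) -> T) -> Prop }.

Inductive term (L : language) :=
| Var of nat
| App (f : fsym L) of ('I_(farity f) -> term L).
Arguments Var {L} _.

(* Variables are de Bruijn indices: [FEx p] binds index 0 of [p]. *)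
Inductive formula (L : language) :=
| FEq of term L & term L
| FRel (r : rsym L) of ('I_(rarity r) -> term L)
| FNot of formula L
| FAnd of formula L & formula L
| FEx of formula L.

Definition scons (T : Type) (a : T) (e : nat -> T) (k : nat) : T :=
  if k is k'.+1 then e k' else a.

Fixpoint eval L T (M : structure L T) (e : nat -> T) (t : term L) : T :=
  match t with
  | Var k => e k
  | App f a => fint M (fun i => eval M e (a i))
  end.

Fixpoint sat L T (M : structure L T) (e : nat -> T) (p : formula L) : Prop :=
  match p with
  | FEq t u => eval M e t = eval M e u
  | FRel r a => rint M (fun i => eval M e (a i))
  | FNot q => ~ sat M e q
  | FAnd q r => sat M e q /\ sat M e r
  | FEx q => exists a, sat M (scons a e) q
  end.

(* The first [n] variables are read in [x], the other ones in [e]. *)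
Definition env (T : Type) n (x : 'rV[T]_n) (e : nat -> T) (k : nat) : T :=
  if insub k is Some i then x 0 i else e (k - n)%N.

(* Definability with parameters: these are the values of [e], of which a
   formula uses only finitely many. *)
Definition definable L T (M : structure L T) n (S : set 'rV[T]_n) :=
  exists (p : formula L) (e : nat -> T), forall x, S x <-> sat M (env x e) p.

Definition definable1 L T (M : structure L T) (S : set T) :=
  definable M [set x : 'rV[T]_1 | S (x 0 0)].

(* A [k]-tuple of elements of [T ^ n] is a [k] x [n] matrix, flattened by
   [mxvec] into an element of [T ^ (k * n)]; [tuple_set R] is the set of those
   [k]-tuples of elements of [D] whose entries satisfy [R]. *)
Definition tuple_set T n (D : set 'rV[T]_n) k (R : ('I_k -> D) -> Prop) :
    set 'rV[T]_(k * n) :=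
  [set z | exists2 x : 'I_k -> D, R x & forall i, row i (vec_mx z) = val (x i)].

(* [N] is interpreted in [M], with domain [D] and coordinate map [pi]. The
   graph of a function symbol has its value at index [ord0]. *)
Definition interpretation L T (M : structure L T) L' T' (N : structure L' T')
    n (D : set 'rV[T]_n) (pi : D -> T') : Prop :=
  [/\ definable M D,
      forall y, exists x, pi x = y,
      definable M (tuple_set (fun x : 'I_2 -> D => pi (x 0) = pi (x 1))),
      forall f : fsym L', definable M (tuple_set
        (fun x : 'I_(farity f).+1 -> D =>
           pi (x ord0) = fint N (fun i => pi (x (lift ord0 i))))) &
      forall r : rsym L', definable M (tuple_set
        (fun x : 'I_(rarity r) -> D => rint N (fun i => pi (x i))))].

Definition interpretable L T (M : structure L T) L' T' (N : structure L' T') :=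
  exists n (D : set 'rV[T]_n) (pi : D -> T'), interpretation M N pi.

Inductive ring_fsym := RZero | ROne | RAdd | ROpp | RMul.

Definition ring_farity (f : ring_fsym) : nat :=
  match f with RZero | ROne => 0 | ROpp => 1 | RAdd | RMul => 2 end.

Definition ring_fint (R : pzRingType) (f : ring_fsym) :
    ('I_(ring_farity f) -> R) -> R :=
  match f with
  | RZero => fun=> 0
  | ROne => fun=> 1
  | RAdd => fun x => x 0 + x 1
  | ROpp => fun x => - x 0
  | RMul => fun x => x 0 * x 1
  end.

Definition ring_lang : language :=
  @Language ring_fsym ring_farity void (fun=> 0%N).

Definition ring_struct (R : pzRingType) : structure ring_lang R :=
  @Structure ring_lang R (@ring_fint R) (fun r _ => match r with end).

Definition ringpred_lang : language :=
  @Language ring_fsym ring_farity unit (fun=> 1%N).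

Definition ringpred_struct (R : pzRingType) (P : set R) :
    structure ringpred_lang R :=
  @Structure ringpred_lang R (@ring_fint R) (fun _ x => P (x ord0)).

Definition sum_lang (L1 L2 : language) : language :=
  @Language (fsym L1 + fsym L2)
    (fun f => match f with inl f => farity f | inr f => farity f end)
    (rsym L1 + rsym L2)
    (fun r => match r with inl r => rarity r | inr r => rarity r end).

Definition sum_struct L1 L2 T (M1 : structure L1 T) (M2 : structure L2 T) :
    structure (sum_lang L1 L2) T :=
  @Structure (sum_lang L1 L2) T
    (fun f => match f with inl f => @fint _ _ M1 f | inr f => @fint _ _ M2 f end)
    (fun r => match r with inl r => @rint _ _ M1 r | inr r => @rint _ _ M2 r end).

Record field_order (K : fieldType) (le : rel K) : Prop := FieldOrder {
  fo_anti : antisymmetric le;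
  fo_trans : transitive le;
  fo_total : total le;
  fo_add : forall x y z, le x y -> le (x + z) (y + z);
  fo_mul : forall x y, le 0 x -> le 0 y -> le 0 (x * y) }.

Definition ordered_case (K : fieldType) (O : set K) : Prop :=
  exists2 le : rel K, field_order le & O = [set x | le (-1) x && le x 1].

(* A valuation, written additively; only its values on [K \ {0}] matter. *)
Record valuation (K : fieldType) (G : porderZmodType) (v : K -> G) : Prop :=
  Valuation {
    val_total : total (<=%R : rel G);
    val_add : forall a b c : G, a <= b -> a + c <= b + c;
    valuationM : forall x y, x != 0 -> y != 0 -> v (x * y) = v x + v y;
    valuationD : forall x y, x != 0 -> y != 0 -> x + y != 0 ->
      v x <= v (x + y) \/ v y <= v (x + y) }.

Definition valued_case (K : fieldType) (O : set K) : Prop :=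
  exists (G : porderZmodType) (v : K -> G),
    [/\ valuation v, exists2 x, x != 0 & v x != 0 &
        O = [set x | x = 0 \/ 0 <= v x]].

(* A language extending that of [(K, O)] is, up to renaming its symbols, the sum
   of the latter and of the language [ext_lang] of the additional symbols. *)
Record expansion := Expansion {
  base_field :> fieldType;
  unit_ball : set base_field;
  unit_ballP : ordered_case unit_ball \/ valued_case unit_ball;
  ext_lang : language;
  ext_struct : structure ext_lang base_field }.

Definition exp_struct (K : expansion) :
    structure (sum_lang ringpred_lang (ext_lang K)) K :=
  sum_struct (ringpred_struct (@unit_ball K)) (ext_struct K).

Section Topology.
Variable K : expansion.
Local Notation O := (@unit_ball K).

(* [|y| <= |x|] and [|y| < |x|] in the totally ordered set
   [{0} U K^* / O^*]. *)
Definition abs_le (y x : K) : Prop := exists2 a, O a & y = x * a.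
Definition abs_lt (y x : K) : Prop := ~ abs_le x y.

(* For [r != 0], [norm_lt x r] is [||x|| < |r|]. *)
Definition norm_lt m (x : 'rV[K]_m) (r : K) : Prop :=
  forall i, abs_lt (x 0 i) r.
Definition norm_le m (x : 'rV[K]_m) (r : K) : Prop :=
  forall i, abs_le (x 0 i) r.

(* The open ball with center [a] and radius [|r|], for [r != 0]. *)
Definition oball m (a : 'rV[K]_m) (r : K) : set 'rV[K]_m :=
  [set x | norm_lt (x - a) r].

Definition K_closed m (S : set 'rV[K]_m) : Prop :=
  forall a, ~ S a -> exists2 r, r != 0 & oball a r `<=` ~` S.

Definition K_bounded m (S : set 'rV[K]_m) : Prop :=
  exists r, forall x, S x -> norm_le x r.

Definition K_isolated m (S : set 'rV[K]_m) (a : 'rV[K]_m) : Prop :=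
  S a /\ exists2 r, r != 0 & S `&` oball a r = [set a].

Definition K_discrete m (S : set 'rV[K]_m) : Prop :=
  forall a, S a -> K_isolated S a.

Definition continuous_on m (X : set 'rV[K]_m) (f : X -> K) : Prop :=
  forall (x : X) eps, eps != 0 -> exists2 del, del != 0 &
    forall y : X, norm_lt (val y - val x) del -> abs_lt (f y - f x) eps.

Definition definable_fun m (X : set 'rV[K]_m) (f : X -> K) : Prop :=
  definable (exp_struct K)
    [set z : 'rV[K]_(m + 1) | exists x : X, z = row_mx (val x) (const_mx (f x))].

Definition cont_def m (X : set 'rV[K]_m) (f : X -> K) : Prop :=
  continuous_on f /\ definable_fun f.

Record dset m := DSet {
  dset_set :> set 'rV[K]_m;
  dsetP : definable (exp_struct K) dset_set }.

Definition zeros m (U : set 'rV[K]_m) (s : U -> K) : set 'rV[K]_m :=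
  [set val u | u in [set u : U | s u = 0]].

Definition definable_nbhd m (X U : set 'rV[K]_m) (p0 : 'rV[K]_m) : Prop :=
  [/\ definable (exp_struct K) U, U `<=` X, U p0 &
      exists2 r, r != 0 & X `&` oball p0 r `<=` U].

Definition vanishes_on_germ m (U : set 'rV[K]_m) (p0 : 'rV[K]_m) (s : U -> K) :=
  zeros s p0 /\ ~ K_isolated (zeros s) p0.

Definition separated_germs m (U : set 'rV[K]_m) (p0 : 'rV[K]_m) k
    (s : 'I_k -> U -> K) : Prop :=
  let S i := zeros (s i) `\ p0 in
  exists2 d : 'I_k -> (U `\ p0) -> K, forall i, cont_def (d i) &
  [/\ forall i j, i != j -> S i `&` S j = set0,
      forall i, vanishes_on_germ p0 (s i),
      forall i j, i != j -> forall u : U `\ p0,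
        (S i (val u) -> d i u = 1) /\ (S j (val u) -> d i u = 0) &
      forall i, exists r, forall u, abs_le (d i u) r].

Definition arbitrarily_many_germs m (X : set 'rV[K]_m) (p0 : 'rV[K]_m) : Prop :=
  forall k, (0 < k)%N ->
  exists (U : set 'rV[K]_m) (s : 'I_k -> U -> K),
    [/\ definable_nbhd X U p0, forall i, cont_def (s i) & separated_germs p0 s].

End Topology.

Section UnitBall.
Variable K : expansion.
Local Notation O := (@unit_ball K).

Let half_ball (F : realFieldType) : [/\
  forall x y : F, (-1 <= x) && (x <= 1) -> (-1 <= y) && (y <= 1) ->
    (-1 <= x * y) && (x * y <= 1),
  forall x : F, (-1 <= x) && (x <= 1) \/ (-1 <= x^-1) && (x^-1 <= 1) &
  forall x y : F, (-1 <= x) && (x <= 1) -> (-1 <= y) && (y <= 1) ->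
    (-1 <= 2^-1 * (x + y)) && (2^-1 * (x + y) <= 1)].
Proof.
split=> [x y|x|x y].
- by rewrite -!ler_norml normrM => ? ?; rewrite mulr_ile1.
- rewrite -!ler_norml normfV; have [?|x1] := leP `|x| 1; first by left.
  by right; rewrite invf_le1 ?ltW // (lt_trans _ x1).
- by move=> /andP[? ?] /andP[? ?]; apply/andP; split; lra.
Qed.

Lemma unit_ball_facts :
  [/\ O 1, O (-1), forall x y, O x -> O y -> O (x * y) &
    (forall x, O x \/ O x^-1) /\
    exists2 h, h != 0 & [/\ O h, ~ O h^-1 &
      exists2 c, c != 0 & forall x y, O x -> O y -> O (c * (x + y))]].
Proof.
case: (unit_ballP K) => [[le [lanti ltr ltot ladd lmul] ->]|].
  have le0N x : le 0 (- x) = le x 0.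
    apply/idP/idP => [/(ladd _ _ x)|/(ladd _ _ (- x))].
      by rewrite add0r addNr.
    by rewrite add0r subrr.
  have subge0 x y : le 0 (y - x) = le x y.
    apply/idP/idP => [/(ladd _ _ x)|/(ladd _ _ (- x))].
      by rewrite add0r subrK.
    by rewrite subrr.
  pose pM := Num.IntegralDomain_isLeReal.Build K
    (Rle := le) (Rlt := fun x y => (y != x) && le x y)
    (norm := fun x => if le 0 x then x else - x).
  have le0D x y : le 0 x -> le 0 y -> le 0 (x + y).
    move=> x0 /(ladd _ _ x); rewrite add0r addrC; exact: ltr.
  have le0a x : le 0 x -> le x 0 -> x = 0.
    by move=> h1 h2; apply: lanti; rewrite h1 h2.
  have normN x : (if le 0 (- x) then - x else - - x) =
                 (if le 0 x then x else - x).
    rewrite le0N opprK; case: ifP => h1; case: ifP => h2 //.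
      by rewrite (le0a x) // oppr0.
    by have := ltot 0 x; rewrite h1 h2.
  have gen x : le 0 x -> (if le 0 x then x else - x) = x by move=> ->.
  pose F : realFieldType := HB.pack (base_field K : Type) (GRing.Field.on K)
    (pM le0D lmul le0a subge0 (ltot 0) normN gen (fun _ _ => erefl)).
  have [hM hV hD] := half_ball F.
  split.
  - by change ((-1 <= 1 :> F) && (1 <= 1 :> F)); rewrite lexx andbT; lra.
  - by change ((-1 <= -1 :> F) && (-1 <= 1 :> F)); rewrite lexx /=; lra.
  - exact: hM.
  - split; first exact: hV.
    have n2 : (2^-1 : F) != 0 by rewrite invr_eq0 pnatr_eq0.
    exists (2^-1 : F) => //; split.
    + by change ((-1 <= 2^-1 :> F) && (2^-1 <= 1 :> F)); apply/andP; split; lra.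
    + rewrite invrK => h.
      by have : (-1 <= 2 :> F) && (2 <= 1 :> F) by []; case/andP=> _; lra.
    + by exists (2^-1 : F) => //; exact: hD.
case=> G [v [[Gtot Gadd vM vD] [x0 x0n vx0] OE]].
have v1 : v 1 = 0.
  have := vM 1 1 (oner_neq0 _) (oner_neq0 _); rewrite mulr1.
  by move/eqP; rewrite -subr_eq subrr => /eqP.
have vV x : x != 0 -> v x^-1 = - v x.
  move=> xn; apply/eqP; rewrite -addr_eq0 addrC -vM ?invr_eq0 ?mulfV //.
  exact/eqP.
have Gadd0 (a b : G) : 0 <= a -> 0 <= b -> 0 <= a + b.
  move=> a0 /(Gadd _ _ a); rewrite add0r addrC; exact: le_trans.
have vN1 : v (-1) = 0.
  have n1 : (-1 : K) != 0 by rewrite oppr_eq0 oner_neq0.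
  have h : v (-1) + v (-1) = 0 by rewrite -vM // mulrNN mulr1.
  have /orP[h0|h0] := Gtot 0 (v (-1)).
    apply/le_anti; rewrite h0 andbT.
    by have := Gadd _ _ (v (-1)) h0; rewrite add0r h.
  apply/le_anti; rewrite h0 /=.
  by have := Gadd _ _ (v (-1)) h0; rewrite add0r h.
have GN (a : G) : (0 <= - a) = (a <= 0).
  apply/idP/idP => [/(Gadd _ _ a)|/(Gadd _ _ (- a))].
    by rewrite add0r addNr.
  by rewrite add0r subrr.
have Oe x : O x <-> x = 0 \/ 0 <= v x by rewrite OE.
split.
- by apply/Oe; right; rewrite v1.
- by apply/Oe; right; rewrite vN1.
- move=> x y; rewrite !Oe => -[->|vx]; first by rewrite mul0r; left.
  case=> [->|vy]; first by rewrite mulr0; left.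
  have [->|xn] := eqVneq x 0; first by rewrite mul0r; left.
  have [->|yn] := eqVneq y 0; first by rewrite mulr0; left.
  by right; rewrite vM //; apply: Gadd0.
- split=> [x|].
    have [->|xn] := eqVneq x 0; first by left; apply/Oe; left.
    have /orP[h|h] := Gtot 0 (v x); first by left; apply/Oe; right.
    by right; apply/Oe; right; rewrite vV // GN.
  have key x : x != 0 -> v x != 0 -> 0 <= v x ->
    exists2 h, h != 0 & O h /\ ~ O h^-1.
    move=> xn vxn vx; exists x => //; split; first by apply/Oe; right.
    move/Oe => -[/eqP|]; first by rewrite invr_eq0 (negPf xn).
    rewrite vV // GN => h; move/negP: vxn; apply.
    by apply/eqP/le_anti; rewrite h vx.
  have [h hn [Oh Ohn]] : exists2 h, h != 0 & O h /\ ~ O h^-1.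
    have /orP[h|h] := Gtot 0 (v x0); first exact: (key x0).
    by apply: (key x0^-1); rewrite ?invr_eq0 // vV ?oppr_eq0 // GN.
  exists h => //; split=> //; exists 1; first exact: oner_neq0.
  move=> x y; rewrite mul1r !Oe => -[->|vx]; first by rewrite add0r.
  case=> [->|vy]; first by rewrite addr0; right.
  have [->|xn] := eqVneq x 0; first by rewrite add0r; right.
  have [->|yn] := eqVneq y 0; first by rewrite addr0; right.
  have [->|xyn] := eqVneq (x + y) 0; first by left.
  by right; case: (vD x y xn yn xyn); apply: le_trans.
Qed.

End UnitBall.
Section Closure.
Variable K : expansion.
Local Notation O := (@unit_ball K).
Local Notation M := (exp_struct K).

Let abs_leW (x y z : K) : abs_le x y -> abs_le y z -> abs_le x z.
Proof.
have [_ _ OM _] := unit_ball_facts K.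
by move=> [a Oa ->] [b Ob ->]; exists (b * a); [exact: OM | rewrite mulrA].
Qed.

Let abs_le_lt (x y z : K) : abs_le x y -> abs_lt y z -> abs_lt x z.
Proof. by move=> xy yz zx; apply: yz; apply: abs_leW zx xy. Qed.

Let abs_lt_le (x y z : K) : abs_lt x y -> abs_le y z -> abs_lt x z.
Proof. by move=> xy yz zx; apply: xy; apply: abs_leW yz zx. Qed.

Let abs_total (x y : K) : abs_le x y \/ abs_le y x.
Proof.
have [O1 _ OM [Oi _]] := unit_ball_facts K.
have O0 : O 0 by case: (Oi 0); rewrite ?invr0.
have [->|xn] := eqVneq x 0; first by left; exists 0; rewrite ?mulr0.
have [->|yn] := eqVneq y 0; first by right; exists 0; rewrite ?mulr0.
case: (Oi (x / y)) => h; [left; exists (x / y)|right; exists (x / y)^-1] => //.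
  by rewrite mulrCA mulfV ?mulr1.
by rewrite invf_div mulrCA mulfV ?mulr1.
Qed.

Let abs_ltW (x y : K) : abs_lt x y -> abs_le x y.
Proof. by move=> xy; case: (abs_total x y). Qed.

Let abs_lt0 (x : K) : x != 0 -> abs_lt 0 x.
Proof. by move=> xn [a _ /eqP]; rewrite mul0r (negPf xn). Qed.

Let small_add (eps : K) : eps != 0 -> exists2 eta, eta != 0 &
  forall a b, abs_lt a eta -> abs_lt b eta -> abs_lt (a + b) eps.
Proof.
have [_ _ _ [_ [h hn [_ hV [c cn hc]]]]] := unit_ball_facts K.
move=> epsn; exists (eps * h * c); first by rewrite !mulf_neq0.
move=> a b /abs_ltW [a' Oa ->] /abs_ltW [b' Ob ->].
apply: (@abs_le_lt _ (eps * h)).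
  by exists (c * (a' + b')); [exact: hc | rewrite mulrDr mulrDr !mulrA].
move=> [d Od]; rewrite -mulrA -{1}[eps]mulr1 => /(mulfI epsn) e1.
apply: hV; suff -> : h^-1 = d by [].
by apply: (mulfI hn); rewrite -e1 mulfV.
Qed.

Let small_mul (c eta : K) : eta != 0 -> exists2 zeta, zeta != 0 &
  forall a, abs_lt a zeta -> abs_lt (c * a) eta.
Proof.
move=> etan; have [->|cn] := eqVneq c 0.
  by exists eta => // a _; rewrite mul0r; apply: abs_lt0.
exists (c^-1 * eta); first by rewrite mulf_neq0 ?invr_eq0.
move=> a h [b Ob e]; apply: h; exists b => //.
by rewrite e !mulrA mulVf // mul1r.
Qed.

Let small_min (d1 d2 : K) : d1 != 0 -> d2 != 0 ->
  exists2 d, d != 0 & forall x, abs_lt x d -> abs_lt x d1 /\ abs_lt x d2.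
Proof.
move=> n1 n2; case: (abs_total d1 d2) => h; [exists d1|exists d2] => // x xd.
  by split=> //; apply: abs_lt_le h.
by split=> //; apply: abs_lt_le h.
Qed.

Section Continuity.
Variables (m : nat) (X : set 'rV[K]_m).
Implicit Types f g : X -> K.

Let cont_pair f g : continuous_on f -> continuous_on g ->
  forall (x : X) e1 e2, e1 != 0 -> e2 != 0 -> exists2 del, del != 0 &
    forall y : X, norm_lt (val y - val x) del ->
      abs_lt (f y - f x) e1 /\ abs_lt (g y - g x) e2.
Proof.
move=> cf cg x e1 e2 /(cf x)[d1 n1 h1] /(cg x)[d2 n2 h2].
have [d dn dP] := small_min n1 n2; exists d => // y yd.
by split; [apply: h1|apply: h2] => i; have [] := dP _ (yd i).
Qed.

Lemma continuous_cst (c : K) : continuous_on (fun _ : X => c).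
Proof.
move=> x eps epsn; exists 1; first exact: oner_neq0.
by move=> y _; rewrite subrr; apply: abs_lt0.
Qed.

Lemma continuous_sub f g :
  continuous_on f -> continuous_on g -> continuous_on (fun x => f x - g x).
Proof.
move=> cf cg x eps /small_add[e1 n1 h1].
have [e2 n2 h2] := small_mul (-1) n1.
have [d dn dP] := cont_pair cf cg x n1 n2; exists d => // y /dP[a b].
have -> : f y - g y - (f x - g x) = (f y - f x) + -1 * (g y - g x) by ring.
by apply: h1 => //; apply: h2.
Qed.

Lemma continuous_mul f g :
  continuous_on f -> continuous_on g -> continuous_on (fun x => f x * g x).
Proof.
move=> cf cg x eps /small_add[e1 n1 h1]; have [e2 n2 h2] := small_add n1.
have [e3 n3 h3] := small_mul (f x) n2; have [e4 n4 h4] := small_mul (g x) n2.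
have [e5 n5 h5] := small_min n4 n1.
have [e6 n6 h6] := small_min n3 (oner_neq0 K).
have [d dn dP] := cont_pair cf cg x n5 n6; exists d => // y /dP.
move=> [/h5[a4 a1] /h6[b3 b1]].
have -> : f y * g y - f x * g x = (f y - f x) * (g y - g x) +
   (f x * (g y - g x) + g x * (f y - f x)) by ring.
apply: h1; last by apply: h2; [exact: h3|exact: h4].
apply: abs_le_lt a1; have [b Ob be] := abs_ltW b1.
by exists b => //; rewrite be mul1r.
Qed.

End Continuity.

Section Renaming.
Variable L : language.

Let up (r : nat -> nat) k := if k is k'.+1 then (r k').+1 else 0%N.

Fixpoint term_rename (r : nat -> nat) (t : term L) : term L :=
  match t with
  | Var k => Var (r k)
  | App f a => App (fun i => term_rename r (a i))
  end.

Fixpoint rename (r : nat -> nat) (p : formula L) : formula L :=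
  match p with
  | FEq t u => FEq (term_rename r t) (term_rename r u)
  | FRel s a => FRel (fun i => term_rename r (a i))
  | FNot q => FNot (rename r q)
  | FAnd q s => FAnd (rename r q) (rename r s)
  | FEx q => FEx (rename (up r) q)
  end.

Lemma eval_rename T (N : structure L T) r e t :
  eval N e (term_rename r t) = eval N (e \o r) t.
Proof. by elim: t => //= f a IH; congr fint; apply/funext. Qed.

Lemma sat_rename T (N : structure L T) r e p :
  sat N e (rename r p) = sat N (e \o r) p.
Proof.
elim: p r e => /= [t u|s a|q IH|q IH q' IH'|q IH] r e.
- by rewrite !eval_rename.
- by congr rint; apply/funext => i; rewrite eval_rename.
- by rewrite IH.
- by rewrite IH IH'.
- congr (@ex T _); apply/funext => a; rewrite IH; congr sat.
  by apply/funext => -[].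
Qed.

Lemma env_lt T n (x : 'rV[T]_n) e k (kn : (k < n)%N) :
  env x e k = x 0 (Ordinal kn).
Proof. by rewrite /env insubT. Qed.

Lemma env_ge T n (x : 'rV[T]_n) e k : env x e (n + k)%N = e k.
Proof. by rewrite /env insubN ?addKn // -leqNgt leq_addr. Qed.

End Renaming.

Section Definability.
Variables (m : nat) (X : set 'rV[K]_m).
Implicit Types f g : X -> K.

Let graph f (z : 'rV[K]_(m + 1)) :=
  exists x : X, z = row_mx (val x) (const_mx (f x)).

Let var_shift b k : nat :=
  if (k < m)%N then k.+2 else if k == m then (~~ b : nat)
  else (m.+1 + (b + (k - m.+1).*2)).+2.

Let param_mix (e1 e2 : nat -> K) k := if odd k then e2 k./2 else e1 k./2.

Let env_shift (z : 'rV[K]_(m + 1)) e1 e2 (u v : K) (b : bool) :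
  scons v (scons u (env z (param_mix e1 e2))) \o var_shift b =
  env (row_mx (lsubmx z) (const_mx (if b then v else u) : 'rV_1)) (if b then e2 else e1).
Proof.
apply/funext => k /=; rewrite /var_shift.
have [km|mk] := ltnP k m.
  have km1 : (k < m + 1)%N by rewrite addn1 ltnS ltnW.
  rewrite /= !(env_lt _ _ km1).
  have -> : Ordinal km1 = lshift 1 (Ordinal km) by apply: val_inj.
  by rewrite row_mxEl !mxE.
have [->|km] := eqVneq k m.
  have mm : (m < m + 1)%N by rewrite addn1.
  rewrite (env_lt _ _ mm).
  have -> : Ordinal mm = rshift m (0 : 'I_1) by apply: val_inj; rewrite /= addn0.
  by rewrite row_mxEr mxE; case: b.
have mlt : (m < k)%N by rewrite ltn_neqAle eq_sym km.
rewrite /= -[m.+1]addn1 env_ge -(subnKC mlt) -[m.+1]addn1 env_ge addKn.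
rewrite /param_mix oddD odd_double addbF oddb.
by case: b; rewrite /= ?uphalf_double ?add0n ?doubleK.
Qed.

Lemma definable_binop f g (op : K -> K -> K) (t : term _) :
  (forall e, eval M e t = op (e 1%N) (e 0%N)) ->
  definable_fun f -> definable_fun g -> definable_fun (fun x => op (f x) (g x)).
Proof.
move=> tE [p [e1 pP]] [q [e2 qP]].
exists (FEx (FEx (FAnd (FAnd (rename (var_shift false) p)
  (rename (var_shift true) q)) (FEq (Var m.+2) t)))), (param_mix e1 e2) => z /=.
have mm : (m < m + 1)%N by rewrite addn1.
have mmE : Ordinal mm = rshift m (0 : 'I_1) by apply: val_inj; rewrite /= addn0.
split=> [[x ->]|[u [v]]].
  exists (f x), (g x); rewrite !sat_rename !env_shift row_mxKl tE /=.
  split; first by split; [apply/pP; exists x|apply/qP; exists x].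
  by rewrite (env_lt _ _ mm) mmE row_mxEr mxE.
rewrite !sat_rename !env_shift tE /= => -[[/pP[x xe] /qP[y ye]]].
have [xl xr] := eq_row_mx xe; have [yl yr] := eq_row_mx ye.
have xy : x = y by apply: val_inj; rewrite -xl -yl.
move: xr yr => /rowP/(_ 0); rewrite !mxE => -> /rowP/(_ 0); rewrite !mxE => ->.
rewrite (env_lt _ _ mm) mmE => zE; exists x; rewrite -{1}[z]hsubmxK xl.
congr row_mx; apply/rowP => i; rewrite !mxE ord1 zE -xy //.
Qed.

Lemma definable_cst (c : K) : definable M X -> definable_fun (fun _ : X => c).
Proof.
move=> [p [e pP]].
pose r k := (if k < m then k else (m + 1 + (k - m).+1))%N.
exists (FAnd (rename r p) (FEq (Var m) (Var (m + 1)%N))), (scons c e) => z /=.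
have mm : (m < m + 1)%N by rewrite addn1.
have mmE : Ordinal mm = rshift m (0 : 'I_1) by apply: val_inj; rewrite /= addn0.
have rE : env z (scons c e) \o r = env (lsubmx z) e.
  apply/funext => k; rewrite /= /r; have [km|mk] := ltnP k m.
    have km1 : (k < m + 1)%N by rewrite addn1 ltnS ltnW.
    rewrite (env_lt _ _ km1) (env_lt _ _ km) mxE; congr (z _ _).
    exact: val_inj.
  by rewrite env_ge -{2}(subnKC mk) env_ge.
rewrite sat_rename rE (env_lt _ _ mm) mmE -{4}[(m + 1)%N]addn0 env_ge /=.
split=> [[x ->]|[/pP Xz zc]].
  rewrite row_mxKl row_mxEr mxE; split=> //; apply/pP; exact: set_valP.
exists (SigSub (mem_set Xz)); rewrite /= -{1}[z]hsubmxK; congr row_mx.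
by apply/rowP => i; rewrite !mxE ord1 zc.
Qed.

End Definability.

Lemma cont_def_subring m (X : dset K m) :
  subring_closed (fun f : X -> K => `[< cont_def f >]).
Proof.
pose rapp (f : ring_fsym) a : term (sum_lang ringpred_lang (ext_lang K)) :=
  @App (sum_lang ringpred_lang (ext_lang K)) (inl f) a.
pose ts := @rapp RAdd (fun i => if i == 0 then Var 1
                              else @rapp ROpp (fun=> Var 0)).
pose tm := @rapp RMul (fun i => if i == 0 then Var 1 else Var 0).
split=> [|f g|f g]; rewrite !unfold_in /=.
- apply/asboolP; split; first exact: continuous_cst.
  exact/definable_cst/dsetP.
- move=> /asboolP[cf df] /asboolP[cg dg]; apply/asboolP; split.
    exact: continuous_sub.
  exact: (@definable_binop _ _ f g (fun u v => u - v) ts).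
- move=> /asboolP[cf df] /asboolP[cg dg]; apply/asboolP; split.
    exact: continuous_mul.
  exact: (@definable_binop _ _ f g (fun u v => u * v) tm).
Qed.

End Closure.

Section Ring.
Variables (K : expansion) (m : nat) (X : dset K m).

Definition cont_def_pred : {pred X -> K} := fun f => `[< cont_def f >].

HB.instance Definition _ :=
  GRing.isSubringClosed.Build (X -> K) cont_def_pred (cont_def_subring X).

Record C_ring := CFun { cfun :> X -> K; _ : cfun \in cont_def_pred }.

HB.instance Definition _ := [isSub for cfun].
HB.instance Definition _ := [Choice of C_ring by <:].
HB.instance Definition _ := GRing.SubChoice_isSubComPzRing.Build
  (X -> K) cont_def_pred C_ring (cont_def_subring X).

Definition C_bounded : set C_ring := [set s | forall x, unit_ball (s x)].

Definition C_struct : structure ringpred_lang C_ring :=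
  ringpred_struct C_bounded.

End Ring.

Section TauZ.
Variables (K : fieldType) (tau : K).

Definition tauZ : set K := range (fun k : int => tau ^ k).

Definition tau_exp (k : int) : tauZ := SigSub (mem_set (imageT _ k)).

Lemma tau_exp_surj (x : tauZ) : exists k, tau_exp k = x.
Proof.
by have [k _ kx] := set_valP x; exists k; apply: val_inj; rewrite /= kx.
Qed.

Definition tau_log (x : tauZ) : int := projT1 (cid (tau_exp_surj x)).

Lemma tau_logK : cancel tau_log tau_exp.
Proof. by move=> x; rewrite /tau_log; case: cid. Qed.

(* The ring structure of [int] carried over by [tau_exp]. *)
Definition tauZ_struct : structure ring_lang tauZ :=
  @Structure ring_lang tauZ
    (fun f x => tau_exp (fint (ring_struct int) (fun i => tau_log (x i))))
    (fun r _ => match r with end).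

End TauZ.

Lemma tau_expK (K : expansion) (tau : K) : tau != 0 -> unit_ball tau ->
  ~ unit_ball tau^-1 -> cancel (@tau_exp K tau) (@tau_log K tau).
Proof.
have [O1 _ OM _] := unit_ball_facts K.
move=> taun tO tV k.
have torsion_free n : tau ^+ n.+1 != 1.
  apply/eqP => tn; apply: tV; suff -> : tau^-1 = tau ^+ n.
    by elim: n {tn} => [|n IH]; rewrite ?expr0 ?exprS //; apply: OM.
  by apply: (mulfI taun); rewrite mulfV // -exprS.
set l := tau_log _.
have lk : tau ^ l = tau ^ k by have /(congr1 val) := tau_logK (tau_exp tau k).
apply/eqP; rewrite -subr_eq0.
have : tau ^ (l - k) = 1 by rewrite expfzDr // lk -expfzDr // subrr expr0z.
case: (l - k) => [[//|n]|n]; first by move/eqP; rewrite (negPf (torsion_free n)).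
by rewrite NegzE -exprnN => /eqP; rewrite invr_eq1 (negPf (torsion_free n)).
Qed.

Section TauEval.
Variables (K : expansion) (m : nat) (X : dset K m) (tau : K) (p0 : X).

Definition tau_dom : set 'rV[C_ring X]_1 := 
  [set x : 'rV[C_ring X]_1 | tauZ tau (x 0 0 p0)].

Definition tau_eval (x : tau_dom) : tauZ tau :=
  SigSub (mem_set (set_valP x : tauZ tau ((val x 0 0) p0))).

End TauEval.

(* Main.v *)
From HB Require Import structures.
Require Import Defs.
From mathcomp Require Import all_boot all_order all_algebra.
From mathcomp Require Import boolp classical_sets functions cardinality.
From mathcomp Require Import ring lra.

Set Implicit Arguments.
Unset Strict Implicit.
Unset Printing Implicit Defensive.

Import Order.TTheory GRing.Theory Num.Theory.

Local Open Scope classical_set_scope.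
Local Open Scope ring_scope.

(* A continuous definable function [delta] with [p0] as its only zero makes
   [f(p0) = 0] a first-order condition: [f(p0) <> 0] iff [f] and [delta] generate
   the unit ideal.  More generally, finitely many functions without common zero
   generate the unit ideal (take a maximum of their absolute values), so that
   common zeros of finitely many functions can be quantified over.  Using
   bounded functions to express small errors, one defines from four functions
   [h1], [h2], [w], [s] the set of those [(c, d)] in [K^2] that are cluster values
   at [p0] of [(h1 / w, h2 / w)] along the zero set of [s].  This set is definable
   in [K] itself, so if its first coordinates are bounded and uniformly separated,
   they are finitely many.  Conversely separated germs [s_1, .., s_k] at [p0]
   produce any prescribed finite set of pairs [(a_i, b_i)]: let [s] be the product
   of the [s_i], let [h1 / w] and [h2 / w] be the sums of the [a_i delta_i] and of
   the [b_i delta_i], and cut everything off near [p0].  Hence [x = a_n] and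
   [z = y ^ n] for some natural number [n], where [a_{i+1} = t a_i + o], is
   expressed by the existence of such a finite set that contains [(a_0, 1)] and is
   closed under [(c, d) |-> (t c + o, y d)] except at [(x, z)].  This defines [Z]
   ([t = o = 1]), the powers of [tau], and the multiplication of exponents. *)

(** * Definability of predicates on environments *)

Section EnvDefinability.
Variables (L : language) (T : Type) (M : structure L T).
Implicit Types (P Q : (nat -> T) -> Prop) (t u : (nat -> T) -> T).

(* A variable [k] of a formula stands for the variable [i] of the environment if
   [v k = inl i] and for the parameter [c] if [v k = inr c]. *)
Definition assign (v : nat -> nat + T) (e : nat -> T) (k : nat) : T :=
  match v k with inl i => e i | inr c => c end.

(** Definability is stated for predicates on whole environments: closure under connectives,
    quantifiers and substitution then replaces explicit formulas and their index bookkeeping. *)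
Definition pdef P :=
  exists (p : formula L) (v : nat -> nat + T),
    forall e, P e <-> sat M (assign v e) p.

Definition pfun t := pdef (fun e => e 0%N = t (fun k => e k.+1)).

Lemma pdef_ext P Q : (forall e, P e <-> Q e) -> pdef P -> pdef Q.
Proof. by move=> PQ [p [v h]]; exists p, v => e; rewrite -PQ. Qed.

Lemma pdef_subst P (w : nat -> nat + T) : pdef P -> pdef (fun e => P (assign w e)).
Proof.
move=> [p [v h]].
exists p, (fun k => match v k with inl i => w i | inr c => inr c end) => e.
rewrite h; suff -> : assign v (assign w e) = assign
  (fun k => match v k with inl i => w i | inr c => inr c end) e by [].
by apply/funext => k; rewrite /assign; case: (v k).
Qed.

Lemma pdef_rename P (r : nat -> nat) : pdef P -> pdef (fun e => P (e \o r)).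
Proof. exact: (@pdef_subst P (fun k => inl (r k))). Qed.

Lemma pdef_not P : pdef P -> pdef (fun e => ~ P e).
Proof. by move=> [p [v h]]; exists (FNot p), v => e /=; rewrite h. Qed.

Lemma pdef_and P Q : pdef P -> pdef Q -> pdef (fun e => P e /\ Q e).
Proof.
move=> [p [v hp]] [q [w hq]].
(* Each formula comes with its own assignment; even indices serve [p] and odd ones [q], so that a
   single assignment carries both. *)
exists (FAnd (rename (fun k => k.*2) p) (rename (fun k => k.*2.+1) q)).
exists (fun k => if odd k then w k./2 else v k./2) => e /=.
rewrite !sat_rename hp hq.
set z := assign (fun k => if odd k then _ else _) e.
have -> : assign v e = z \o (fun k => k.*2).
  by apply/funext => k; rewrite /z /assign /= odd_double doubleK.
have -> // : assign w e = z \o (fun k => k.*2.+1).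
by apply/funext => k; rewrite /z /assign /= odd_double /= uphalf_double.
Qed.

Lemma pdef_ex (P : T -> (nat -> T) -> Prop) :
  pdef (fun e => P (e 0%N) (fun k => e k.+1)) -> pdef (fun e => exists a, P a e).
Proof.
move=> [p [v h]].
(* Every variable that reads entry 0 of the environment is merged into the bound variable 0; the
   others move up by one and read one entry lower. *)
pose r k := if v k is inl 0 then 0%N else k.+1.
pose w k := match v k with inl i => inl i.-1 | inr c => inr c end.
exists (FEx (rename r p)), w => e /=.
have E a : (scons a (assign w e)) \o r = assign v (scons a e).
  apply/funext => k; rewrite /= /r /assign /=.
  case vk: (v k) => [[|i]|c] //=; by rewrite /w vk.
split=> -[a] Pa; exists a.
  by rewrite sat_rename E -h.
by move: Pa; rewrite sat_rename E -h.
Qed.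

Lemma pdef_or P Q : pdef P -> pdef Q -> pdef (fun e => P e \/ Q e).
Proof.
move=> hP hQ; have := pdef_not (pdef_and (pdef_not hP) (pdef_not hQ)).
by apply: pdef_ext => e; rewrite -not_orP notK.
Qed.

Lemma pdef_imp P Q : pdef P -> pdef Q -> pdef (fun e => P e -> Q e).
Proof.
move=> hP hQ; have := pdef_not (pdef_and hP (pdef_not hQ)).
apply: pdef_ext => e; split=> [h p|h [/h]] //.
by apply: contrapT => q; apply: h.
Qed.

Lemma pdef_all (P : T -> (nat -> T) -> Prop) :
  pdef (fun e => P (e 0%N) (fun k => e k.+1)) -> pdef (fun e => forall a, P a e).
Proof.
move=> hP; have := pdef_not (pdef_ex (P := fun a e => ~ P a e) (pdef_not hP)).
by apply: pdef_ext => e; split=> [h a|h [a]]; [apply: contrapT => ?; apply: h; exists a|].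
Qed.

Lemma pdef_const (A : Prop) : pdef (fun=> A).
Proof.
have [a|a] := pselect A.
  by exists (FEx (FEq (Var 0) (Var 0))), inl => e /=; split=> // _; exists (e 0%N).
by exists (FNot (FEq (Var 0) (Var 0))), inl => e /=; split=> // /(_ erefl).
Qed.

Lemma pdef_forall (I : finType) (P : I -> (nat -> T) -> Prop) :
  (forall i, pdef (P i)) -> pdef (fun e => forall i, P i e).
Proof.
move=> hP; suff H (r : seq I) : pdef (fun e => forall i, i \in r -> P i e).
  apply: pdef_ext (H (enum I)) => e; split=> h i.
    by apply: h; rewrite mem_enum.
  by move=> _; apply: h.
elim: r => [|j r IH]; first exact: pdef_ext (pdef_const True).
apply: pdef_ext (pdef_and (hP j) IH) => e.
split=> [[e1 e2] i|h]; first by rewrite inE => /orP[/eqP ->|/e2].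
by split=> [|i ir]; apply: h; rewrite inE ?eqxx ?ir ?orbT.
Qed.

Lemma pdef_ex2 (P Q : T -> (nat -> T) -> Prop) :
  pdef (fun e => P (e 0%N) (fun k => e k.+1)) ->
  pdef (fun e => Q (e 0%N) (fun k => e k.+1)) ->
  pdef (fun e => exists2 a, P a e & Q a e).
Proof.
move=> hP hQ; have := pdef_ex (P := fun a e => P a e /\ Q a e) (pdef_and hP hQ).
by apply: pdef_ext => e; split=> [[a []]|[a]]; exists a.
Qed.

Lemma pfun_var k : pfun (fun e => e k).
Proof. by exists (FEq (Var 0) (Var k.+1)), inl. Qed.

Lemma pfun_cst c : pfun (fun=> c).
Proof.
by exists (FEq (Var 0) (Var 1)), (fun k => if k is 0%N then inl 0%N else inr c).
Qed.

Lemma pfun_rename t (r : nat -> nat) : pfun t -> pfun (fun e => t (e \o r)).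
Proof. exact: (@pdef_rename _ (fun k => if k is j.+1 then (r j).+1 else 0%N)). Qed.

Lemma pdef_app (P : T -> (nat -> T) -> Prop) t :
  pdef (fun e => P (e 0%N) (fun k => e k.+1)) -> pfun t ->
  pdef (fun e => P (t e) e).
Proof.
move=> hP ht; have := pdef_ex (P := fun a e => a = t e /\ P a e) (pdef_and ht hP).
by apply: pdef_ext => e; split=> [[a [->]]|h] //; exists (t e).
Qed.

Lemma pdef_rel1 (R : T -> Prop) t :
  pdef (fun e => R (e 0%N)) -> pfun t -> pdef (fun e => R (t e)).
Proof. exact: (@pdef_app (fun a _ => R a)). Qed.

Lemma pdef_rel2 (R : T -> T -> Prop) t u :
  pdef (fun e => R (e 0%N) (e 1%N)) -> pfun t -> pfun u ->
  pdef (fun e => R (t e) (u e)).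
Proof.
move=> hR ht hu; apply: (@pdef_app (fun a e => R a (u e))) ht.
apply: (@pdef_app (fun b e => R (e 0%N) b) (fun e => u (fun k => e k.+1))).
  exact: (pdef_rename (fun k => if k is 0%N then 1%N else 0%N) hR).
exact: (pfun_rename succn hu).
Qed.

Lemma pdef_eq t u : pfun t -> pfun u -> pdef (fun e => t e = u e).
Proof. by apply: pdef_rel2; exists (FEq (Var 0) (Var 1)), inl. Qed.

Lemma pfun_op1 (op : T -> T) t :
  pfun (fun e => op (e 0%N)) -> pfun t -> pfun (fun e => op (t e)).
Proof.
move=> ho ht.
apply: (@pdef_app (fun a e => e 0%N = op a) (fun e => t (fun k => e k.+1))).
  exact: (pdef_rename (fun k => if k is 0%N then 1%N else 0%N) ho).
exact: (pfun_rename succn ht).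
Qed.

Lemma pfun_op2 (op : T -> T -> T) t u :
  pfun (fun e => op (e 0%N) (e 1%N)) -> pfun t -> pfun u ->
  pfun (fun e => op (t e) (u e)).
Proof.
move=> ho ht hu.
apply: (@pdef_app (fun a e => e 0%N = op a (u (fun k => e k.+1)))
          (fun e => t (fun k => e k.+1))); last exact: (pfun_rename succn ht).
apply: (@pdef_app (fun b e => e 1%N = op (e 0%N) b)
          (fun e => u (fun k => e k.+2))).
  exact: (pdef_rename (fun k => match k with 0 => 2 | 1 => 1 | _ => 0 end%N) ho).
exact: (pfun_rename (fun k => k.+2) hu).
Qed.

Lemma pfun_if P t u : pdef P -> pfun t -> pfun u ->
  pfun (fun e => if pselect (P e) then t e else u e).
Proof.
move=> hP ht hu.
have hP' : pdef (fun e => P (fun k => e k.+1)) := pdef_rename succn hP.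
have := pdef_and (pdef_imp hP' ht) (pdef_imp (pdef_not hP') hu).
apply: pdef_ext => e; case: pselect => h; split=> [[h1 h2]|e0].
- exact: h1.
- by split.
- exact: h2.
- by split.
Qed.

Definition rowe n (e : nat -> T) : 'rV[T]_n := \row_(i < n) e i.

Lemma env_size n (x : 'rV[T]_n) e : env x e n = e 0%N.
Proof. by have := env_ge x e 0; rewrite addn0. Qed.

Lemma pdef_exrow n (P : 'rV[T]_n -> (nat -> T) -> Prop) :
  pdef (fun e => P (rowe n e) (fun k => e (n + k)%N)) ->
  pdef (fun e => exists x, P x e).
Proof.
elim: n P => [|n IH] P hP.
  apply: pdef_ext hP => e; split=> [h|[x]]; first by eexists; exact: h.
  suff -> : rowe 0 e = x by [].
  by apply/rowP => -[].
pose ext (x : 'rV[T]_n) a := rowe n.+1 (env x (fun=> a)).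
apply: (@pdef_ext (fun e => exists x a, P (ext x a) e)).
  move=> e; split=> [[x [a h]]|[x h]]; first by exists (ext x a).
  exists (\row_i x 0 (widen_ord (leqnSn n) i)), (x 0 ord_max).
  suff -> : ext (\row_i x 0 (widen_ord (leqnSn n) i)) (x 0 ord_max) = x by [].
  apply/rowP => i; rewrite !mxE; have [lt_in|] := ltnP i n.
    rewrite (env_lt _ _ lt_in) mxE; congr (x _ _); exact: val_inj.
  move=> le_ni; have -> : i = ord_max.
    by apply/val_inj/eqP; rewrite /= eqn_leq le_ni -ltnS ltn_ord.
  by rewrite /= env_size.
apply: (IH (fun x e => exists a, P (ext x a) e)).
apply: (pdef_ex (P := fun a e => P (ext (rowe n e) a) (fun k => e (n + k)%N))).
(* Once bound, the last coordinate [a] has index 0 and the other [n] have indices 1 to [n]; [r] puts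
   [a] back behind them. *)
pose r k := if (k < n)%N then k.+1 else if k == n then 0%N else k.
apply: pdef_ext (pdef_rename r hP) => e.
suff [-> ->] : rowe n.+1 (e \o r) = ext (rowe n (fun k => e k.+1)) (e 0%N) /\
  (fun k => (e \o r) (n.+1 + k)%N) = (fun k => e (n + k).+1) by [].
split; last first.
  apply/funext => k /=; rewrite /r ltnNge (leq_trans (leqnSn n)) ?leq_addr //=.
  by rewrite eq_sym ltn_eqF // addSn ltnS leq_addr.
apply/rowP => i; rewrite !mxE /= /r; have [lt_in|le_ni] := ltnP i n.
  by rewrite (env_lt _ _ lt_in) mxE.
have -> : (i : nat) = n by apply/eqP; rewrite eqn_leq le_ni -ltnS ltn_ord.
by rewrite eqxx env_size.
Qed.

Lemma definable_pdef n (S : set 'rV[T]_n) :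
  definable M S -> pdef (fun e => S (rowe n e)).
Proof.
move=> [p [e0 h]].
exists p, (fun k => if (k < n)%N then inl k else inr (e0 (k - n)%N)) => e.
rewrite h; suff -> : env (rowe n e) e0 = assign
  (fun k => if (k < n)%N then inl k else inr (e0 (k - n)%N)) e by [].
apply/funext => k; rewrite /assign; have [lt_kn|le_nk] := ltnP k n.
  by rewrite (env_lt _ _ lt_kn) mxE.
by rewrite -{1}(subnKC le_nk) env_ge.
Qed.

Lemma rowe_env n (x : 'rV[T]_n) e : rowe n (env x e) = x.
Proof.
apply/rowP => i; rewrite mxE (env_lt _ _ (ltn_ord i)); congr (x _ _).
exact: val_inj.
Qed.

Lemma pdef_definable (t0 : T) n (S : set 'rV[T]_n) :
  pdef (fun e => S (rowe n e)) -> definable M S.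
Proof.
move=> [p [v h]].
(* [S] depends only on the first [n] entries, so the rest of the environment is set to [t0]; a
   variable [k] that reads none of these entries becomes the parameter number [k]. *)
pose r k := if v k is inl i then if (i < n)%N then i else (n + k)%N else (n + k)%N.
exists (rename r p), (fun k => if v k is inr c then c else t0) => x.
rewrite -{1}(rowe_env x (fun=> t0)) h sat_rename.
suff -> : assign v (env x (fun=> t0)) =
  env x (fun k => if v k is inr c then c else t0) \o r by [].
apply/funext => k; rewrite /= /assign /r; case vk: (v k) => [i|c] /=; last first.
  by rewrite env_ge vk.
have [lt_in|le_ni] := ltnP i n; first by rewrite !(env_lt _ _ lt_in).
by rewrite env_ge vk -(subnKC le_ni) env_ge.
Qed.

End EnvDefinability.

(** * Ring operations as definable functions *)

Section RingTerms.
Variables (L : language) (R : pzRingType) (M : structure L R).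

Definition ring_terms := exists app : forall f : ring_fsym,
    ('I_(ring_farity f) -> term L) -> term L,
  forall e f a, eval M e (app f a) = ring_fint (fun i => eval M e (a i)).

Hypothesis MR : ring_terms.
Implicit Types t u : (nat -> R) -> R.

Lemma pfunD t u : pfun M t -> pfun M u -> pfun M (fun e => t e + u e).
Proof.
case: MR => app appE; apply: (pfun_op2 (op := fun x y => x + y)).
exists (FEq (Var 0) (app RAdd (fun i => if i == 0 then Var 1 else Var 2))), inl.
by move=> e /=; rewrite appE.
Qed.

Lemma pfunM t u : pfun M t -> pfun M u -> pfun M (fun e => t e * u e).
Proof.
case: MR => app appE; apply: (pfun_op2 (op := fun x y => x * y)).
exists (FEq (Var 0) (app RMul (fun i => if i == 0 then Var 1 else Var 2))), inl.
by move=> e /=; rewrite appE.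
Qed.

Lemma pfunN t : pfun M t -> pfun M (fun e => - t e).
Proof.
case: MR => app appE; apply: (pfun_op1 (op := fun x => - x)).
exists (FEq (Var 0) (app ROpp (fun=> Var 1))), inl.
by move=> e /=; rewrite appE.
Qed.

Lemma pfunB t u : pfun M t -> pfun M u -> pfun M (fun e => t e - u e).
Proof. by move=> ht hu; apply: pfunD => //; apply: pfunN. Qed.

End RingTerms.

Lemma ringpred_ring_terms (R : pzRingType) (P : set R) :
  ring_terms (ringpred_struct P).
Proof. by exists (fun f => @App ringpred_lang f). Qed.

Lemma exp_ring_terms (K : expansion) : ring_terms (exp_struct K).
Proof.
by exists (fun f => @App (sum_lang ringpred_lang (ext_lang K)) (inl f)).
Qed.

Lemma pdef_ringpred (R : pzRingType) (P : set R) t :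
  pfun (ringpred_struct P) t -> pdef (ringpred_struct P) (fun e => P (t e)).
Proof.
apply: pdef_rel1.
by exists (@FRel ringpred_lang tt (fun=> Var 0)), inl.
Qed.

Lemma pdef_unit_ball (K : expansion) t :
  pfun (exp_struct K) t -> pdef (exp_struct K) (fun e => @unit_ball K (t e)).
Proof.
apply: (pdef_rel1 (R := fun x => unit_ball x)).
by exists (@FRel (sum_lang ringpred_lang (ext_lang K)) (inl tt) (fun=> Var 0)), inl.
Qed.

(** * The absolute value *)

Section Abs.
Variable K : expansion.
Local Notation O := (@unit_ball K).
Implicit Types x y z a b c d r eps eta : K.

Lemma ballM x y : O x -> O y -> O (x * y).
Proof. by have [_ _ h _] := unit_ball_facts K; apply: h. Qed.

Lemma ball1 : O 1.
Proof. by have [] := unit_ball_facts K. Qed.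

Lemma ball0 : O 0.
Proof. by have [_ _ _ [/(_ 0) h _]] := unit_ball_facts K; case: h; rewrite ?invr0. Qed.

Lemma abs_lexx x : abs_le x x.
Proof. by exists 1; rewrite ?mulr1 //; exact: ball1. Qed.

Lemma abs_le0 x : abs_le 0 x.
Proof. by exists 0; rewrite ?mulr0 //; exact: ball0. Qed.

Lemma abs_le1 x : abs_le x 1 <-> O x.
Proof. by split=> [[a Oa ->]|Ox]; [rewrite mul1r|exists x; rewrite ?mul1r]. Qed.

Lemma abs_lex0 x : abs_le x 0 -> x = 0.
Proof. by case=> a _; rewrite mul0r. Qed.

Lemma abs_le_trans x y z : abs_le x y -> abs_le y z -> abs_le x z.
Proof.
by move=> [a Oa ->] [b Ob ->]; exists (b * a); [exact: ballM|rewrite mulrA].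
Qed.

Lemma abs_le_lt_trans x y z : abs_le x y -> abs_lt y z -> abs_lt x z.
Proof. by move=> xy yz zx; apply: yz; apply: abs_le_trans zx xy. Qed.

Lemma abs_lt_le_trans x y z : abs_lt x y -> abs_le y z -> abs_lt x z.
Proof. by move=> xy yz zx; apply: xy; apply: abs_le_trans yz zx. Qed.

Lemma abs_le_total x y : abs_le x y \/ abs_le y x.
Proof.
have [_ _ _ [Oi _]] := unit_ball_facts K.
have [->|xn] := eqVneq x 0; first by left; apply: abs_le0.
have [->|yn] := eqVneq y 0; first by right; apply: abs_le0.
case: (Oi (x / y)) => h; [left; exists (x / y)|right; exists (x / y)^-1] => //.
  by rewrite mulrCA mulfV ?mulr1.
by rewrite invf_div mulrCA mulfV ?mulr1.
Qed.

Lemma abs_ltW x y : abs_lt x y -> abs_le x y.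
Proof. by move=> xy; case: (abs_le_total x y). Qed.

Lemma abs_leN x y : abs_le (- x) y <-> abs_le x y.
Proof.
have [_ ON _ _] := unit_ball_facts K.
have H z : abs_le z y -> abs_le (- z) y.
  move=> [a Oa ->]; exists (-1 * a); first exact: ballM.
  by rewrite mulN1r mulrN.
by split=> /H //; rewrite opprK.
Qed.

Lemma abs_ltN x y : abs_lt x y -> abs_lt (- x) y.
Proof. by move=> h; apply: abs_le_lt_trans h; apply/abs_leN/abs_lexx. Qed.

Lemma abs_lt_subC x y z : abs_lt (x - y) z -> abs_lt (y - x) z.
Proof. by move=> /abs_ltN; rewrite opprB. Qed.

Lemma abs_leM x y x' y' : abs_le x y -> abs_le x' y' -> abs_le (x * x') (y * y').
Proof.
by move=> [a Oa ->] [b Ob ->]; exists (a * b); [exact: ballM|ring].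
Qed.

Lemma abs_leMl z x y : z != 0 -> abs_le (z * x) (z * y) <-> abs_le x y.
Proof.
move=> zn; split=> [[a Oa]|h]; last exact: abs_leM (abs_lexx z) h.
by rewrite -mulrA => /(mulfI zn) ->; exists a.
Qed.

Lemma abs_lt0 x : x != 0 -> abs_lt 0 x.
Proof. by move=> xn /abs_lex0 x0; rewrite x0 eqxx in xn. Qed.

Lemma abs_lt_neq0 x y : abs_lt x y -> y != 0.
Proof. by move=> h; apply/eqP => y0; apply: h; rewrite y0; apply: abs_le0. Qed.

Lemma abs_lt_small : exists2 h : K, h != 0 & abs_lt h 1.
Proof.
have [_ _ _ [_ [h hn [_ hV _]]]] := unit_ball_facts K.
exists h => // -[a Oa e]; apply: hV; suff -> : h^-1 = a by [].
by apply: (mulfI hn); rewrite -e mulfV.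
Qed.

Lemma abs_lt_dense y : y != 0 -> exists2 x, x != 0 & abs_lt x y.
Proof.
move=> yn; have [h hn h1] := abs_lt_small; exists (y * h); first exact: mulf_neq0.
by rewrite /abs_lt -{1}[y]mulr1 abs_leMl.
Qed.

(** The constant [c] (one half in the ordered case, 1 in the valued case) brings sums of two
    elements of O back into O, a uniform substitute for the triangle inequality. *)
Lemma abs_lt_add eps : eps != 0 -> exists2 eta, eta != 0 &
  forall a b, abs_lt a eta -> abs_lt b eta -> abs_lt (a + b) eps.
Proof.
have [_ _ _ [_ [h hn [_ hV [c cn hc]]]]] := unit_ball_facts K.
move=> epsn; have [e en eL] := abs_lt_dense epsn.
exists (e * c); first by rewrite !mulf_neq0.
move=> a b /abs_ltW [a' Oa ->] /abs_ltW [b' Ob ->].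
apply: (abs_le_lt_trans _ eL).
by exists (c * (a' + b')); [exact: hc | rewrite mulrDr mulrDr !mulrA].
Qed.

Lemma abs_lt_mul (c eta : K) : eta != 0 -> exists2 zeta, zeta != 0 &
  forall a, abs_lt a zeta -> abs_lt (c * a) eta.
Proof.
move=> etan; have [->|cn] := eqVneq c 0.
  by exists eta => // a _; rewrite mul0r; apply: abs_lt0.
exists (c^-1 * eta); first by rewrite mulf_neq0 ?invr_eq0.
move=> a h e; apply: h; rewrite -[a](mulKf cn).
by apply/abs_leMl; rewrite ?invr_eq0.
Qed.

Lemma abs_min2 (d1 d2 : K) : d1 != 0 -> d2 != 0 ->
  exists2 d, d != 0 & abs_le d d1 /\ abs_le d d2.
Proof.
move=> n1 n2; case: (abs_le_total d1 d2) => h; [exists d1|exists d2] => //;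
  by split=> //; apply: abs_lexx.
Qed.

Lemma abs_min_seq (s : seq K) : exists2 d, d != 0 &
  forall x, x \in s -> x != 0 -> abs_lt d x.
Proof.
elim: s => [|y s [d dn dP]]; first by exists 1; rewrite ?oner_eq0.
have [y0|yn] := eqVneq y 0.
  by exists d => // x; rewrite in_cons => /orP[/eqP ->|/dP//]; rewrite y0 eqxx.
have [z zn zy] := abs_lt_dense yn.
have [q qn [qd qz]] := abs_min2 dn zn; exists q => // x.
rewrite in_cons => /orP[/eqP -> _|xs xn]; first exact: abs_le_lt_trans zy.
by apply: abs_le_lt_trans qd _; apply: dP.
Qed.

Lemma abs_max_seq (s : seq K) : exists r, forall x, x \in s -> abs_le x r.
Proof.
elim: s => [|y s [r rP]]; first by exists 0.
case: (abs_le_total y r) => h.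
  by exists r => x; rewrite in_cons => /orP[/eqP ->|/rP].
exists y => x; rewrite in_cons => /orP[/eqP ->|/rP]; first exact: abs_lexx.
by move/abs_le_trans; apply.
Qed.

Lemma abs_le_add (x y : K) : exists r, forall a b, abs_le a x -> abs_le b y ->
  abs_le (a + b) r.
Proof.
have [c cn hc] : exists2 c : K, c != 0 & forall x y, O x -> O y -> O (c * (x + y)).
  by have [_ _ _ [_ [h hn [_ hV [c]]]]] := unit_ball_facts K; exists c.
have [r [rx ry]] : exists r, abs_le x r /\ abs_le y r.
  by case: (abs_le_total x y) => h; [exists y|exists x]; split=> //; apply: abs_lexx.
exists (r / c) => a b.
move=> /abs_le_trans - /(_ _ rx) [a' Oa ->] /abs_le_trans - /(_ _ ry) [b' Ob ->].
by exists (c * (a' + b')); [exact: hc|rewrite mulrA mulfVK // mulrDr].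
Qed.

(** [F] is K with its order packed as a real field and [i] is the identity; ordered arithmetic
    becomes available without touching the ring structure of K. *)
Lemma ordered_ball : ordered_case O ->
  exists (F : realFieldType) (i : {rmorphism K -> F}),
    forall x, O x <-> `|i x| <= 1.
Proof.
case=> [le [lanti ltr ltot ladd lmul] OE].
  have le0N x : le 0 (- x) = le x 0.
    by apply/idP/idP => [/(ladd _ _ x)|/(ladd _ _ (- x))]; rewrite add0r ?addNr ?subrr.
  have subge0 x y : le 0 (y - x) = le x y.
    by apply/idP/idP => [/(ladd _ _ x)|/(ladd _ _ (- x))]; rewrite ?add0r ?subrK ?subrr.
  have le0D x y : le 0 x -> le 0 y -> le 0 (x + y).
    by move=> x0 /(ladd _ _ x); rewrite add0r addrC; apply: ltr.
  have le0a x : le 0 x -> le x 0 -> x = 0.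
    by move=> h1 h2; apply: lanti; rewrite h1 h2.
  have normN x : (if le 0 (- x) then - x else - - x) =
                 (if le 0 x then x else - x).
    rewrite le0N opprK; case: ifP => h1; case: ifP => h2 //.
      by rewrite (le0a x) // oppr0.
    by have := ltot 0 x; rewrite h1 h2.
  have gen x : le 0 x -> (if le 0 x then x else - x) = x by move=> ->.
  pose pM := Num.IntegralDomain_isLeReal.Build K
    le0D lmul le0a subge0 (ltot 0) normN gen (fun _ _ => erefl).
  pose F : realFieldType := HB.pack (base_field K : Type) (GRing.Field.on K) pM.
  exists F, idfun => x; rewrite OE /=.
  by change (le (-1) x && le x 1 <-> `|x : F| <= 1); rewrite ler_norml.
Qed.

Lemma ball_cases :
  (exists (F : realFieldType) (i : {rmorphism K -> F}),
     forall x, O x <-> `|i x| <= 1) \/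
  (forall x y, O x -> O y -> O (x + y)).
Proof.
case: (unit_ballP K) => [/ordered_ball|Oval]; [by left|right].
case: Oval => G [v [[Gtot Gadd vM vD] _ ->]] x y [->|vx]; first by rewrite add0r.
case=> [->|vy]; first by rewrite addr0; right.
have [->|xn] := eqVneq x 0; first by rewrite add0r; right.
have [->|yn] := eqVneq y 0; first by rewrite addr0; right.
have [->|xyn] := eqVneq (x + y) 0; first by left.
by right; case: (vD x y xn yn xyn); apply: le_trans.
Qed.

Lemma abs_le_norm (F : realFieldType) (i : {rmorphism K -> F}) :
  (forall x, O x <-> `|i x| <= 1) ->
  forall x y, abs_le x y <-> `|i x| <= `|i y|.
Proof.
move=> Oi x y; split=> [[a /Oi Oa ->]|].
  by rewrite rmorphM normrM ler_piMr.
have [->|yn] := eqVneq y 0.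
  by rewrite rmorph0 normr0 normr_le0 fmorph_eq0 => /eqP ->; apply: abs_le0.
move=> h; exists (x / y); last by rewrite mulrCA mulfV ?mulr1.
by apply/Oi; rewrite fmorph_div normf_div ler_pdivrMr ?mul1r // normr_gt0 fmorph_eq0.
Qed.

Lemma abs_le_ultra : (forall x y, O x -> O y -> O (x + y)) ->
  forall x y z, abs_le x z -> abs_le y z -> abs_le (x + y) z.
Proof.
move=> OD x y z [a Oa ->] [b Ob ->].
by exists (a + b); [apply: OD|rewrite mulrDr].
Qed.

Lemma abs_lt_ultra : (forall x y, O x -> O y -> O (x + y)) ->
  forall x y z, abs_lt x z -> abs_lt y z -> abs_lt (x + y) z.
Proof.
move=> OD x y z xz yz; case: (abs_le_total x y) => h.
  by apply: abs_le_lt_trans yz; apply: abs_le_ultra => //; apply: abs_lexx.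
by apply: abs_le_lt_trans xz; apply: abs_le_ultra => //; apply: abs_lexx.
Qed.

(** In the ordered case |a| - |r| equals |a - r| or |a + r| according to the signs, so the smaller
    of these two is a suitable radius. In the valued case |a| is one, since |x| < |a| forces |x - a|
    = |a|. *)
Lemma abs_gt_open (r a : K) : abs_lt r a ->
  exists2 d, d != 0 & forall x, abs_lt (x - a) d -> abs_lt r x.
Proof.
move=> ra; case: ball_cases => [[F [i Oi]]|OD].
  have E := abs_le_norm Oi.
  have ra' : `|i r| < `|i a| by rewrite ltNge; apply/negP => /E.
  have n1 : a - r != 0.
    by apply/eqP => /subr0_eq e; rewrite e ltxx in ra'.
  have n2 : a + r != 0.
    apply/eqP => /eqP; rewrite addr_eq0 => /eqP e.
    by rewrite e rmorphN normrN ltxx in ra'.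
  have [d dn [/E d1 /E d2]] := abs_min2 n1 n2.
  exists d => // x xd /E rx; apply: xd; apply/E.
  move: d1 d2 ra' rx; rewrite !(rmorphD, rmorphN, rmorphB) /= => d1 d2 ra' rx.
  have h1 := lerB_dist (i a) (i x); rewrite distrC in h1.
  have [h|h] : `|i a - i r| = `|i a| - `|i r| \/ `|i a + i r| = `|i a| - `|i r|.
    have [a0|a0] := lerP 0 (i a); have [r0|r0] := lerP 0 (i r).
    - left; rewrite (ger0_norm a0) (ger0_norm r0) in ra' *.
      by rewrite ger0_norm // subr_ge0 ltW.
    - right; rewrite (ger0_norm a0) (ltr0_norm r0) in ra' *.
      by rewrite ger0_norm ?opprK //; lra.
    - right; rewrite (ltr0_norm a0) (ger0_norm r0) in ra' *.
      by rewrite ler0_norm ?opprD //; lra.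
    - left; rewrite (ltr0_norm a0) (ltr0_norm r0) in ra' *.
      by rewrite ler0_norm ?opprB; lra.
  - lra.
  - lra.
exists a; first exact: abs_lt_neq0 ra.
move=> x xa xr; have xa' := abs_le_lt_trans xr ra.
have := abs_lt_ultra OD xa' (abs_lt_subC xa).
by rewrite addrC subrK; apply; apply: abs_lexx.
Qed.

(* In the valued case, [|a - a'|] or [|b - b'|] is at least [|a|]. *)
Lemma abs_sqr_cross : exists2 C : K, C != 0 & forall a b a' b',
  abs_le b a -> ~ abs_le b' a' ->
  abs_le (a ^+ 2 - b ^+ 2) (C * ((a - a') * a)) \/
  abs_le (a ^+ 2 - b ^+ 2) (C * ((b - b') * a)).
Proof.
case: ball_cases => [[F [i Oi]]|OD].
  (* Since |a'| < |b'|, the difference |a| - |b| is at most twice the larger of |a - a'| and |b -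
     b'|, and |a| + |b| is at most 2 |a|; hence the factor 4. *)
  have E := abs_le_norm Oi; exists 4.
    by rewrite -(fmorph_eq0 i) rmorph_nat pnatr_eq0.
  move=> a b a' b' /E h1 h2.
  have {h2} : `|i a'| < `|i b'| by rewrite ltNge; apply/negP => /E.
  rewrite !E !(rmorphM, rmorphB, rmorph_nat, rmorphXn) /= !normrM normr_nat => h2.
  have Y : `|i a ^+ 2 - i b ^+ 2| = `|i a| ^+ 2 - `|i b| ^+ 2.
    rewrite -[i a ^+ 2]real_normK ?num_real // -[i b ^+ 2]real_normK ?num_real //.
    by rewrite [LHS]ger0_norm // subr_ge0 lerXn2r ?nnegrE.
  rewrite Y.
  have h3 := lerB_dist (i a) (i a'); have h4 := lerB_dist (i b') (i b).
  rewrite [`|i b' - _|]distrC in h4.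
  have na := normr_ge0 (i a); have nb := normr_ge0 (i b).
  have bound p : `|i a| - `|i b| <= 2 * p ->
      `|i a| ^+ 2 - `|i b| ^+ 2 <= 4 * (p * `|i a|).
    move=> hp; have -> : 4 * (p * `|i a|) = (2 * p) * (2 * `|i a|) by ring.
    by rewrite subr_sqr; apply: ler_pM; rewrite ?subr_ge0 ?addr_ge0 //; lra.
  by have [h5|h5] := leP `|i b - i b'| `|i a - i a'|; [left|right]; apply: bound; lra.
exists 1; first exact: oner_neq0.
move=> a b a' b' ba ba'.
suff [h|h] : abs_le a (a - a') \/ abs_le a (b - b').
- left; rewrite mul1r; apply: abs_le_trans (abs_leM h (abs_lexx a)).
  apply: abs_le_ultra => //; rewrite ?abs_leN ?expr2; first exact: abs_lexx.
  exact: abs_leM.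
- right; rewrite mul1r; apply: abs_le_trans (abs_leM h (abs_lexx a)).
  apply: abs_le_ultra => //; rewrite ?abs_leN ?expr2; first exact: abs_lexx.
  exact: abs_leM.
apply: contrapT => /not_orP[h1 h2]; apply: ba'.
have aa' : abs_le a a'.
  apply: contrapT => h3; have := abs_lt_ultra OD h3 h1.
  by rewrite addrC subrK; apply; apply: abs_lexx.
apply: abs_le_trans aa'.
have := abs_le_ultra OD ba (abs_ltW (abs_ltN h2)).
by rewrite opprB addrC subrK.
Qed.

End Abs.

(** * Continuous definable functions *)

Section DefinableFunctions.
Variables (K : expansion) (m : nat).
Local Notation M := (exp_struct K).
Implicit Types (V : set 'rV[K]_m) (t u : (nat -> K) -> K).

Lemma pdef_abs_le t u : pfun M t -> pfun M u ->
  pdef M (fun e => @abs_le K (t e) (u e)).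
Proof.
move=> ht hu; apply: (pdef_ex2 (P := fun a _ => @unit_ball K a)
  (Q := fun a e => t e = u e * a)).
  exact/pdef_unit_ball/pfun_var.
apply: pdef_eq; first exact: (pfun_rename succn ht).
apply: pfunM; [exact: exp_ring_terms|exact: (pfun_rename succn hu)|exact: pfun_var].
Qed.

Definition extz (V : set 'rV[K]_m) (f : V -> K) (x : 'rV[K]_m) : K :=
  if insub x is Some u then f u else 0.

Lemma extz_val V (f : V -> K) (u : V) : extz f (val u) = f u.
Proof. by rewrite /extz valK. Qed.

Lemma extz_out V (f : V -> K) x : ~ V x -> extz f x = 0.
Proof. by move=> Vx; rewrite /extz insubF //; apply/negP => /set_mem. Qed.

Lemma in_set_ex (V : set 'rV[K]_m) x : V x -> exists u : V, val u = x.
Proof. by move=> Vx; exists (SigSub (mem_set Vx)). Qed.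

Lemma graph_extz (V : set 'rV[K]_m) (f : V -> K) (e : nat -> K) :
  (exists x : V, rowe (m + 1) e = row_mx (val x) (const_mx (f x))) <->
  V (rowe m e) /\ e m = extz f (rowe m e).
Proof.
have rE : rowe (m + 1) e = row_mx (rowe m e) (const_mx (e m)).
  apply/rowP => i; rewrite !mxE; case: splitP => j ->; rewrite !mxE //.
  by rewrite ord1 addn0.
rewrite rE; split=> [[x]|[/in_set_ex[x xE] eE]].
  move/eq_row_mx => [-> /rowP/(_ 0)]; rewrite !mxE extz_val => ->.
  by split=> //; apply: set_valP.
by exists x; rewrite eE -xE extz_val.
Qed.

Lemma pfun_extz (V : set 'rV[K]_m) (f : V -> K) :
  definable M V -> definable_fun f -> pfun M (fun e => extz f (rowe m e)).
Proof.
move=> /definable_pdef hV /definable_pdef hf.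
have hV' := pdef_rename succn hV.
have {}hf := pdef_rename (fun k => if (k < m)%N then k.+1 else 0%N)
  (pdef_ext (graph_extz f) hf).
have h0 : pdef M (fun e => e 0%N = 0) := pdef_eq (pfun_var _ 0) (pfun_cst _ 0).
have := pdef_or hf (pdef_and (pdef_not hV') h0).
apply: pdef_ext => e.
have -> : rowe m (e \o (fun k => if (k < m)%N then k.+1 else 0%N)) =
    rowe m (fun k => e k.+1).
  by apply/rowP => i; rewrite !mxE /= ltn_ord.
rewrite /= ltnn; split=> [[[_ ->]//|[Vx ->]]|h]; first by rewrite extz_out.
have [Vx|Vx] := pselect (V (rowe m (fun k => e k.+1))); first by left.
by right; split=> //; rewrite h extz_out.
Qed.

Lemma pfun_definable_fun (V : set 'rV[K]_m) (f : V -> K) F :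
  definable M V -> pfun M (fun e => F (rowe m e)) ->
  (forall x, f x = F (val x)) -> definable_fun f.
Proof.
move=> /definable_pdef hV hF fF; apply: (pdef_definable 0).
have hF' := pdef_rename (fun k => if k is j.+1 then j else m) hF.
apply: pdef_ext (pdef_and hV hF') => e /=.
rewrite graph_extz; split=> -[Vx eE]; split=> //; rewrite eE;
  have [u <-] := in_set_ex Vx; by rewrite extz_val fF.
Qed.

End DefinableFunctions.

(** * Continuous functions on a set X *)

Section Continuity.
Variables (K : expansion) (m : nat) (X : set 'rV[K]_m).
Implicit Types (f g u : X -> K) (x y : X) (eps eta c : K).

Definition nearby x (P : X -> Prop) : Prop :=
  exists2 del : K, del != 0 & forall y, norm_lt (val y - val x) del -> P y.

Lemma nearby_and x P Q : nearby x P -> nearby x Q -> nearby x (fun y => P y /\ Q y).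
Proof.
move=> [d dn dP] [d' dn' dP'].
have [e en [ed ed']] := abs_min2 dn dn'; exists e => // y ye.
by split; [apply: dP|apply: dP'] => i; apply: abs_lt_le_trans (ye i) _.
Qed.

Lemma nearby_mono x (P Q : X -> Prop) :
  (forall y, P y -> Q y) -> nearby x P -> nearby x Q.
Proof. by move=> PQ [d dn dP]; exists d => // y /dP/PQ. Qed.

Lemma nearby_self x P : nearby x P -> P x.
Proof. by move=> [d dn]; apply=> i; rewrite subrr mxE; apply: abs_lt0. Qed.

Lemma nearby_zero u x eps : continuous_on u -> u x = 0 -> eps != 0 ->
  nearby x (fun y => abs_lt (u y) eps).
Proof.
by move=> cu ux en; have := cu x eps en; apply: nearby_mono => y; rewrite ux subr0.
Qed.

Lemma nearby_ge f x : continuous_on f -> f x != 0 ->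
  exists2 eta : K, eta != 0 & nearby x (fun y => abs_le eta (f y)).
Proof.
move=> cf fx; have [eta en eP] := abs_lt_add fx; exists eta => //.
have := cf x eta en; apply: nearby_mono => y h.
apply: contrapT => h'; have := eP _ _ h' (abs_ltN h).
by rewrite opprB addrC subrK; apply; apply: abs_lexx.
Qed.

Lemma continuous_inv f : continuous_on f -> (forall x, f x != 0) ->
  continuous_on (fun x => (f x)^-1).
Proof.
move=> cf fn x eps en; have [eta an] := nearby_ge cf (fn x).
(* [u] is 1/f(y) - 1/f(x) with [eta] in place of f(y) in the common denominator; it vanishes at [x]
   and dominates that difference where |eta| <= |f(y)|. *)
pose u y := (f x - f y) * ((f x)^-1 * eta^-1).
have cu : continuous_on u.
  apply: continuous_mul; last exact: continuous_cst.
  by apply: continuous_sub => //; apply: continuous_cst.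
have ux : u x = 0 by rewrite /u subrr mul0r.
move=> h; have := nearby_and h (nearby_zero cu ux en).
apply: nearby_mono => y [[a Oa ea]]; apply: abs_le_lt_trans.
exists a => //; move: an; rewrite /u ea mulf_eq0 negb_or => /andP[_ an].
by field; rewrite an !fn.
Qed.

(* With this function, [max(|f|, |g|) ^ 4] becomes a combination of [f] and [g]
   with continuous coefficients, without any division. *)
Definition sqr_cut a b : K := if pselect (abs_le b a) then a ^+ 2 - b ^+ 2 else 0.

(** When [x] and [y] lie on the same side of the condition |g| <= |f|, the increment is that of f^2
    - g^2 or 0. Otherwise one of the two values is 0, and [abs_sqr_cross] bounds the other by
    products that tend to 0 as [y] tends to [x]. *)
Lemma continuous_sqr_cut f g : continuous_on f -> continuous_on g ->
  continuous_on (fun x => sqr_cut (f x) (g x)).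
Proof.
move=> cf cg x eps en; have [C Cn CP] := abs_sqr_cross K.
have cst c := @continuous_cst K m X c.
pose p y := f y * f y - g y * g y - (f x * f x - g x * g x).
have cp : continuous_on p.
  by do !apply: continuous_sub; rewrite //; apply: continuous_mul.
have cross u z : continuous_on u -> continuous_on z -> u x = 0 ->
    nearby x (fun y => abs_lt (C * (u y * z y)) eps).
  move=> cu cz ux; apply: nearby_zero => //; last by rewrite ux mul0r mulr0.
  by do !apply: continuous_mul.
have sub f' : continuous_on f' -> continuous_on (fun y => f' y - f' x).
  by move=> ?; apply: continuous_sub.
have sub' f' : continuous_on f' -> continuous_on (fun y => f' x - f' y).
  by move=> ?; apply: continuous_sub.
have px : p x = 0 by rewrite /p subrr.
have := nearby_zero cp px en.
move/(nearby_and (cross _ _ (sub' _ cf) (cst (f x)) (subrr _))).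
move/(nearby_and (cross _ _ (sub' _ cg) (cst (f x)) (subrr _))).
move/(nearby_and (cross _ _ (sub _ cf) cf (subrr _))).
move/(nearby_and (cross _ _ (sub _ cg) cf (subrr _))).
apply: nearby_mono => y [h1 [h2 [h3 [h4]]]]; rewrite /p /sqr_cut !expr2.
case: pselect => hy; case: pselect => hx //= hp.
- rewrite subr0 -!expr2; have [h|h] := CP _ _ _ _ hy hx.
    exact: abs_le_lt_trans h h2.
  exact: abs_le_lt_trans h h1.
- rewrite sub0r -!expr2; apply: abs_ltN; have [h|h] := CP _ _ _ _ hx hy.
    exact: abs_le_lt_trans h h4.
  exact: abs_le_lt_trans h h3.
- by rewrite subrr; apply: abs_lt0.
Qed.

Lemma continuous_coord i : continuous_on (fun x : X => val x 0 i).
Proof.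
by move=> x eps en; exists eps => // y /(_ i); rewrite !mxE.
Qed.

End Continuity.

(** * Ideals and common zeros in C(X) *)

Section FunctionRing.
Variables (K : expansion) (m : nat) (X : dset K m).
Local Notation M := (exp_struct K).
Local Notation C := (C_ring X).
Implicit Types (f g N : C) (fs : seq C) (x p : X) (c eps eta : K).

Lemma C_ext f g : (forall x, f x = g x) -> f = g.
Proof. by move=> fg; apply/val_inj/funext. Qed.

Lemma C_cont_def f : cont_def f.
Proof. exact/asboolP/(valP f). Qed.

Lemma C_cont f : continuous_on f.
Proof. by case: (C_cont_def f). Qed.

Lemma pfun_C f : pfun M (fun e => extz f (rowe m e)).
Proof. by apply: pfun_extz; [exact: dsetP|case: (C_cont_def f)]. Qed.

Lemma C_intro (f : X -> K) F : continuous_on f -> pfun M (fun e => F (rowe m e)) ->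
  (forall x, f x = F (val x)) -> exists g, forall x, g x = f x.
Proof.
move=> cf hF fF; have df := pfun_definable_fun (@dsetP _ _ X) hF fF.
by exists (CFun (asboolT (conj cf df))).
Qed.

Lemma C_cst_subproof c : (fun=> c) \in cont_def_pred (X := X).
Proof.
apply/asboolP; split; first exact: continuous_cst.
exact: (definable_cst c (@dsetP _ _ X)).
Qed.

Definition C_cst c : C := CFun (C_cst_subproof c).

Lemma C_coord i : exists f, forall x, f x = val x 0 i.
Proof.
apply: (C_intro (F := fun z => z 0 i)) => //; first exact: continuous_coord.
by apply: pdef_ext (pfun_var _ i) => e; rewrite mxE.
Qed.

Lemma C_sqr_cut f g : exists k : C, forall x, k x = sqr_cut (f x) (g x).
Proof.
apply: (C_intro (F := fun z => sqr_cut (extz f z) (extz g z))).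
- by apply: continuous_sqr_cut; apply: C_cont.
- rewrite /sqr_cut; apply: pfun_if; last exact: pfun_cst.
    by apply: pdef_abs_le; apply: pfun_C.
  have sq h : pfun M (fun e => extz (h : C) (rowe m e) ^+ 2).
    under eq_fun do rewrite expr2.
    by apply: pfunM; [exact: exp_ring_terms|exact: pfun_C|exact: pfun_C].
  by apply: pfunB => //; exact: exp_ring_terms.
- by move=> x; rewrite !extz_val.
Qed.

Lemma C_inv f : (forall x, f x != 0) -> exists u : C, u * f = 1.
Proof.
move=> fn; have [u uE] : exists u : C, forall x, u x = (f x)^-1.
  apply: (C_intro (F := fun z => (extz f z)^-1)).
  - exact: continuous_inv (C_cont f) fn.
  - apply: (pfun_op1 (op := GRing.inv)); last exact: pfun_C.
    have e0 := pfun_var M 0; have e1 := pfun_var M 1; have c := pfun_cst M.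
    have := pdef_or (pdef_and (pdef_eq e0 (c 0)) (pdef_eq e1 (c 0)))
      (pdef_eq (pfunM (@exp_ring_terms K) e1 e0) (c 1)).
    apply: pdef_ext => e; split=> [[[-> ->]|h]|->].
    + by rewrite invr0.
    + have en : e 1%N != 0.
        by apply/eqP => e10; move/eqP: h; rewrite e10 mul0r eq_sym oner_eq0.
      by apply: (mulfI en); rewrite h mulfV.
    + have [->|en] := eqVneq (e 1%N) 0; first by left; rewrite invr0.
      by right; rewrite mulfV.
  - by move=> x; rewrite extz_val.
exists u; apply: C_ext => x; rewrite -[LHS]/(u x * f x) uE mulVf //.
Qed.

Lemma C_join f g : exists N a b, N = a * f + b * g /\
  forall x, N x = if pselect (abs_le (g x) (f x)) then f x ^+ 4 else g x ^+ 4.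
Proof.
have [k kE] := C_sqr_cut f g.
(* If k = f^2 - g^2, this sum is (f^2 - g^2) f^2 + f^2 g^2 = f^4; if k = 0, it is g^4. *)
exists (k * f * f + (g * (g * g + k)) * g), (k * f), (g * (g * g + k)).
split=> // x; rewrite -[LHS]/(k x * f x * f x + (g x * (g x * g x + k x)) * g x).
by rewrite kE /sqr_cut; case: pselect => h /=; ring.
Qed.

Fixpoint ideal fs N : Prop :=
  if fs is f :: fs' then exists a b, ideal fs' b /\ N = a * f + b else N = 0.

Lemma idealM fs N g : ideal fs N -> ideal fs (g * N).
Proof.
elim: fs N g => [|f fs IH] N g /=; first by move=> ->; rewrite mulr0.
move=> [a [b [hb ->]]]; exists (g * a), (g * b); split; first exact: IH.
by rewrite mulrDr mulrA.
Qed.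

Lemma ideal_vanish fs N x : ideal fs N -> (forall f, f \in fs -> f x = 0) -> N x = 0.
Proof.
elim: fs N => [|f fs IH] N /=; first by move=> ->.
move=> [a [b [hb ->]]] h.
rewrite -[LHS]/(a x * f x + b x) (h f) ?inE ?eqxx // mulr0 add0r.
by apply: IH => // g gfs; apply: h; rewrite inE gfs orbT.
Qed.

Lemma abs_pow4 a b : ~ abs_lt a b -> abs_le (b ^+ 4) ((a : K) ^+ 4).
Proof.
move=> /contrapT h; have h2 := abs_leM h h; have := abs_leM h2 h2.
by rewrite -!expr2 -!exprM.
Qed.

(** Iterated joins give an element of the ideal that is small only where all generators are. Without
    common zeros it is invertible; for differences of coordinates it measures the distance to a
    point. *)
Lemma ideal_join fs : exists2 N, ideal fs N &
  forall eps, eps != 0 -> exists2 eta, eta != 0 &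
    forall x, abs_le (N x) eta -> forall f, f \in fs -> abs_lt (f x) eps.
Proof.
elim: fs => [|f fs [N hN NP]]; first by exists 0 => // eps en; exists eps.
have [N' [a [b [N'E N'P]]]] := C_join f N; exists N'.
  by exists a, (b * N); split=> //; apply: idealM.
move=> eps en; have [eta an aP] := NP eps en.
have [e0 e0n [e0e e0a]] := abs_min2 en an.
have [z zn zP] := abs_lt_dense (expf_neq0 4 e0n); exists z => // x Nz.
have {Nz}[hf hN'] : abs_lt (f x) e0 /\ abs_lt (N x) e0.
  move: Nz; rewrite N'P; case: pselect => h Nz.
    have fe : abs_lt (f x) e0.
      by apply: contrapT => /abs_pow4 h4; apply: zP; apply: abs_le_trans Nz.
    by split=> //; apply: abs_le_lt_trans fe.
  have Ne : abs_lt (N x) e0.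
    by apply: contrapT => /abs_pow4 h4; apply: zP; apply: abs_le_trans Nz.
  by split=> //; apply: abs_le_lt_trans Ne; case: (abs_le_total (N x) (f x)).
move=> g; rewrite inE => /orP[/eqP ->|gfs]; first exact: abs_lt_le_trans e0e.
by apply: aP => //; apply/abs_ltW; apply: abs_lt_le_trans e0a.
Qed.

Lemma small_eq0 (a : K) : (forall eps, eps != 0 -> abs_lt a eps) -> a = 0.
Proof.
move=> h; apply/eqP; apply: contrapT => /negP an.
by have := h a an; apply; apply: abs_lexx.
Qed.

(** A Nullstellensatz: without a common zero the join [N] vanishes nowhere, so it is a unit of C(X)
    lying in the ideal. *)
Lemma ideal1P fs : ideal fs 1 <-> ~ exists x, forall f, f \in fs -> f x = 0.
Proof.
split=> [h [x hx]|h].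
  by have := ideal_vanish h hx; move/eqP; rewrite -[_ x]/(1 : K) oner_eq0.
have [N hN NP] := ideal_join fs.
have [|u <-] := C_inv (f := N); last exact: idealM.
move=> x; apply/eqP => Nx; apply: h; exists x => f ffs.
apply: small_eq0 => eps en; have [eta _] := NP eps en.
by apply=> //; rewrite Nx; apply: abs_le0.
Qed.

(** The sets |d| <= |eta| are cofinal among the neighborhoods of [p], which says more than that [p]
    is the only zero of [d]. *)
Definition separating p (d : C) := d p = 0 /\
  forall P, nearby p P -> exists2 eta, eta != 0 & forall x, abs_le (d x) eta -> P x.

Lemma separating_ex p : exists d, separating p d.
Proof.
have /choice [X_ XE] : forall i, exists f : C, forall x, f x = val x 0 i - val p 0 i.
  move=> i; have [f fE] := C_coord i.
  by exists (f - C_cst (val p 0 i)) => x; rewrite -(fE x).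
have [d hd dP] := ideal_join [seq X_ i | i <- enum 'I_m].
exists d; split=> [|P [del /dP[eta an aP] h]].
  by apply: ideal_vanish hd _ => f /mapP[i _ ->]; rewrite XE subrr.
exists eta => // x /aP {}aP; apply: h => i.
by rewrite !mxE -(XE i x); apply: aP; apply: map_f; rewrite mem_enum.
Qed.

Lemma val_neq_coord (x y : X) : val x <> val y -> exists i, val x 0 i - val y 0 i != 0.
Proof.
move=> xy; apply: contrapT => h; apply: xy; apply/rowP => i.
by apply/eqP; rewrite -subr_eq0; apply: contrapT => /negP ?; apply: h; exists i.
Qed.

Lemma nearby_neq x p : x <> p -> nearby x (fun y => y <> p).
Proof.
move=> xp; have [|i hi] := @val_neq_coord x p; first by move/val_inj.
exists (val x 0 i - val p 0 i) => // y /(_ i) h yp; move: h; rewrite yp !mxE.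
by move/abs_lt_subC; apply; apply: abs_lexx.
Qed.

Lemma separating_eq0 p d x : separating p d -> d x = 0 -> x = p.
Proof.
move=> [_ dP] dx; apply: contrapT => xp.
have [eta _] := dP _ (@nearby_neq p x (fun e => xp (esym e))).
by move=> /(_ x); rewrite dx => h; apply: h => //; apply: abs_le0.
Qed.

End FunctionRing.

(** * Cluster values at p0 *)

Section Clusters.
Variables (K : expansion) (m : nat) (X : dset K m) (p0 : X) (delta : C_ring X).
Hypothesis sep : separating p0 delta.
Local Notation C := (C_ring X).
Local Notation M := (exp_struct K).
Local Notation MC := (C_struct X).
Implicit Types (f g h w s : C) (x : X) (eps eta : K).

(* [(c, d)] is a cluster value at [p0] of [(h1 / w, h2 / w)] along the zeros of
   [s], in a form that needs no division by [w]. *)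
Definition clus (h1 h2 w s : C) (c d : K) : Prop := forall eps, eps != 0 ->
  exists x : X, [/\ x <> p0, s x = 0, abs_le (delta x) eps,
    abs_le (h1 x - c * w x) (eps * w x) & abs_le (h2 x - d * w x) (eps * w x)].

Lemma delta_neq0 x : x <> p0 <-> delta x != 0.
Proof.
split=> [xp|dx xp]; last by rewrite xp sep.1 eqxx in dx.
by apply/eqP => /(separating_eq0 sep).
Qed.

(** The functions are definable over K, so this projection is a definable subset of K; this is how
    the finiteness hypothesis on K acts on data quantified in C(X). *)
Lemma definable_clus_proj (h1 h2 w s : C) :
  definable M [set z : 'rV[K]_1 | exists d, clus h1 h2 w s (z 0 0) d].
Proof.
have MR := @exp_ring_terms K.
apply: (pdef_definable 0).
apply: (@pdef_ext _ K M (fun e => exists d, forall eps, eps != 0 ->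
  exists z : 'rV[K]_m, [/\ dset_set X z, extz delta z != 0, extz s z = 0,
    abs_le (extz delta z) eps &
    abs_le (extz h1 z - e 0%N * extz w z) (eps * extz w z) /\
    abs_le (extz h2 z - d * extz w z) (eps * extz w z)])).
  move=> e; rewrite /= mxE; split=> -[d h]; exists d => eps /h.
    move=> [z [/in_set_ex[x <-]]]; rewrite !extz_val => dx sx de [h1e h2e].
    by exists x; split=> //; apply/delta_neq0.
  move=> [x [/delta_neq0 xp sx de h1e h2e]]; exists (val x); rewrite !extz_val.
  by split=> //; apply: set_valP.
apply: pdef_ex; cbv beta.
apply: pdef_all; cbv beta.
have nz t : pfun M t -> pdef M (fun e => t e != 0).
  move=> ht; apply: pdef_ext (pdef_not (pdef_eq ht (pfun_cst _ 0))) => e.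
  by split=> /eqP.
apply: pdef_imp; first exact/nz/pfun_var.
apply: pdef_exrow; cbv beta.
have D f := pfun_C f; have V k := pfun_var M k.
(* Behind the [m] coordinates of the point stand [eps], [d] and the candidate [c], in this order. *)
apply: (@pdef_ext _ _ _ (fun e => dset_set X (rowe m e) /\ (extz delta (rowe m e) != 0 /\
   (extz s (rowe m e) = 0 /\ (abs_le (extz delta (rowe m e)) (e (m + 0)%N) /\
    (abs_le (extz h1 (rowe m e) - e (m + 2)%N * extz w (rowe m e))
            (e (m + 0)%N * extz w (rowe m e)) /\
     abs_le (extz h2 (rowe m e) - e (m + 1)%N * extz w (rowe m e))
            (e (m + 0)%N * extz w (rowe m e)))))))).
  by move=> e; split=> [[? [? [? [?]]]]|[]].
apply: pdef_and; first exact: definable_pdef (dsetP X).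
apply: pdef_and; first exact/nz/D.
apply: pdef_and; first exact: pdef_eq (D s) (pfun_cst _ 0).
apply: pdef_and; first exact: pdef_abs_le (D delta) (V _).
apply: pdef_and; apply: pdef_abs_le.
- by apply: (pfunB MR) (D h1) (pfunM MR (V _) (D w)).
- by apply: (pfunM MR) (V _) (D w).
- by apply: (pfunB MR) (D h2) (pfunM MR (V _) (D w)).
- by apply: (pfunM MR) (V _) (D w).
Qed.

Let MCR : ring_terms MC := @ringpred_ring_terms (C_ring X) (@C_bounded K m X).
Implicit Types (t u : (nat -> C) -> C) (ts : seq ((nat -> C) -> C)).

Fixpoint all_pfun ts : Prop :=
  if ts is t :: ts' then pfun MC t /\ all_pfun ts' else True.

Lemma pdef_ideal ts u : all_pfun ts -> pfun MC u ->
  pdef MC (fun e => ideal [seq t e | t <- ts] (u e)).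
Proof.
move=> hts; apply: (pdef_app (P := fun a e => ideal [seq t e | t <- ts] a)).
elim: ts hts => [_|t ts IH [ht hts]] /=.
  exact: pdef_eq (pfun_var _ 0) (pfun_cst _ 0).
apply: pdef_ex; apply: pdef_ex; cbv beta; apply: pdef_and.
  exact: (pdef_rename (fun k => if k is j.+1 then j.+3 else 0%N) (IH hts)).
apply: pdef_eq; first exact: pfun_var.
apply: (pfunD MCR); last exact: pfun_var.
apply: (pfunM MCR); first exact: pfun_var.
exact: (pfun_rename (fun k => k.+3) ht).
Qed.

Lemma value_neq0P f : f p0 != 0 <-> ideal [:: f; delta] 1.
Proof.
rewrite ideal1P; split=> [fp [x hx]|h].
  have dx : delta x = 0 by apply: hx; rewrite !inE eqxx orbT.
  move: fp; rewrite -(separating_eq0 sep dx) hx ?eqxx // inE eqxx //.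
apply/eqP => fp; apply: h; exists p0 => g; rewrite !inE => /orP[]/eqP -> //.
exact: sep.1.
Qed.

Lemma pdef_neq0 t : pfun MC t -> pdef MC (fun e => t e p0 != 0).
Proof.
move=> ht; apply: (@pdef_ext _ _ _ (fun e => ideal [:: t e; delta] 1)).
  by move=> e; rewrite value_neq0P.
apply: (pdef_ideal (ts := [:: t; fun=> delta])); last exact: pfun_cst.
by do !split=> //; exact: pfun_cst.
Qed.

Lemma pdef_value_eq t u : pfun MC t -> pfun MC u ->
  pdef MC (fun e => t e p0 = u e p0).
Proof.
move=> ht hu; apply: pdef_ext (pdef_not (pdef_neq0 (pfunB MCR ht hu))) => e.
rewrite -[(t e - u e) p0]/(t e p0 - u e p0) subr_eq0.
by split=> [/negP/negbNE/eqP|->] //; rewrite eqxx.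
Qed.

(** Elements of K are represented by values at [p0]; constant functions show that all of them
    occur. *)
Lemma pdef_exK (P : K -> (nat -> C) -> Prop) :
  pdef MC (fun e => P (e 0%N p0) (fun k => e k.+1)) ->
  pdef MC (fun e => exists c, P c e).
Proof.
move=> h; apply: pdef_ext (pdef_ex (P := fun f e => P (f p0) e) h) => e.
by split=> -[c]; [exists (c p0)|exists (C_cst X c)].
Qed.

Lemma pdef_allK (P : K -> (nat -> C) -> Prop) :
  pdef MC (fun e => P (e 0%N p0) (fun k => e k.+1)) ->
  pdef MC (fun e => forall c, P c e).
Proof.
move=> h; apply: pdef_ext (pdef_all (P := fun f e => P (f p0) e) h) => e.
by split=> H c; [exact: (H (C_cst X c))|exact: H].
Qed.

(** The predicate for bounded functions supplies the multipliers in O: a bounded [b] has b(p0) in O,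
    and constants realize all of O. *)
Lemma pdef_value_le t u : pfun MC t -> pfun MC u ->
  pdef MC (fun e => abs_le (t e p0) (u e p0)).
Proof.
move=> ht hu.
apply: (@pdef_ext _ _ _ (fun e => exists2 b, C_bounded b & t e p0 = (u e * b) p0)).
  move=> e; split=> [[b Bb ->]|[a Oa ->]]; first by exists (b p0).
  by exists (C_cst X a).
apply: (pdef_ex2 (P := fun b _ => C_bounded b) (Q := fun b e => t e p0 = (u e * b) p0)).
  exact/pdef_ringpred/pfun_var.
apply: (pdef_value_eq (t := fun e => t (fun k => e k.+1))
  (u := fun e => u (fun k => e k.+1) * e 0%N)); first exact: (pfun_rename succn ht).
apply: (pfunM MCR); last exact: pfun_var.
exact: (pfun_rename succn hu).
Qed.

(** A point other than [p0] is coded by a function [th] that vanishes there but not at [p0];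
    [ideal1P] turns the conditions on [th] into statements on whether 1 belongs to an ideal. *)
Lemma pdef_common_zero ts : all_pfun ts ->
  pdef MC (fun e => exists x, x <> p0 /\
    forall f, f \in [seq t e | t <- ts] -> f x = 0).
Proof.
move=> hts; apply: (@pdef_ext _ _ _ (fun e => exists th, ideal [:: th; delta] 1 /\
  ~ ideal (th :: [seq t e | t <- ts]) 1)).
  move=> e; split=> [[th [/ideal1P h1]]|[x [xp hx]]].
    rewrite ideal1P => /contrapT[x hx]; exists x; split=> [xp|f fF].
      apply: h1; exists x => f; rewrite !inE => /orP[]/eqP ->.
        by apply: hx; rewrite inE eqxx.
      by rewrite xp sep.1.
    by apply: hx; rewrite inE fF orbT.
  have [th sth] := separating_ex x; exists th; rewrite !ideal1P; split.
    move=> [y hy]; have e1 : th y = 0 by apply: hy; rewrite !inE eqxx.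
    have e2 : delta y = 0 by apply: hy; rewrite !inE eqxx orbT.
    by apply: xp; rewrite -(separating_eq0 sth e1) (separating_eq0 sep e2).
  by apply; exists x => f; rewrite inE => /orP[/eqP ->|/hx //]; exact: sth.1.
apply: pdef_ex; cbv beta; have V := pfun_var MC 0; apply: pdef_and.
  apply: (pdef_ideal (ts := [:: fun e => e 0%N; fun=> delta])); last exact: pfun_cst.
  by do !split=> //; exact: pfun_cst.
pose ts' := [seq (fun e => t (fun k => e k.+1)) | t <- ts].
apply: (@pdef_ext _ _ _ (fun e => ~ ideal [seq t e | t <- (@^~ 0%N) :: ts'] 1)).
  by move=> e; rewrite /= -map_comp.
apply/pdef_not/pdef_ideal; last exact: pfun_cst.
split=> //; elim: {+}ts hts @ts' => //= t ts0 IH [ht hts]; split; last exact: IH.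
exact: (pfun_rename succn ht).
Qed.

(* As [f] and [g] are only known near [p0] up to a small error, their values at
   [p0] can be compared with [h1 / w] and [h2 / w] only in the limit; bounded
   multiples [b_i * e] of a function with [e p0 <> 0] play the part of errors. *)
Lemma clusP (h1 h2 w s f g : C) : clus h1 h2 w s (f p0) (g p0) <->
  forall e : C, e p0 != 0 -> exists b1, C_bounded b1 /\ exists b2, C_bounded b2 /\
    exists b3, C_bounded b3 /\ exists x, x <> p0 /\ forall u : C,
      u \in [:: s; h1 - (f + b1 * e) * w; h2 - (g + b2 * e) * w; delta - b3 * e] ->
      u x = 0.
Proof.
split=> [hc e ep|hc eps en].
  have [eta an near_e] := nearby_ge (C_cont e) ep.
  have [z zn zP] := abs_lt_add an.
  have near_f := C_cont f p0 zn; have near_g := C_cont g p0 zn.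
  have [r rn rP] := sep.2 _ (nearby_and near_e (nearby_and near_f near_g)).
  have [z' zn' z'P] := abs_lt_dense zn.
  have [r1 rn1 [r1r r1a]] := abs_min2 rn an; have [r2 rn2 [r2r1 r2z]] := abs_min2 rn1 zn'.
  have [x [xp sx dx h1x h2x]] := hc r2 rn2.
  have [ex [fx gx]] := rP x (abs_le_trans dx (abs_le_trans r2r1 r1r)).
  (* The error from replacing f'(p0) by f'(x), together with the cluster error [r2 * o], is below
     |eta|, hence a multiple of e(x) by some [q] in O. Only the value at [x] matters, so a constant
     function does. *)
  have key (k f' : C) : abs_lt (f' x - f' p0) z ->
      abs_le (k x - f' p0 * w x) (r2 * w x) ->
      exists b : C, C_bounded b /\ k x - (f' x + b x * e x) * w x = 0.
    move=> fx' [o Oo ho].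
    have lt1 : abs_lt (r2 * o) z.
      apply: abs_le_lt_trans z'P; apply: abs_le_trans r2z; by exists o.
    have [q Oq hq] := abs_le_trans (abs_ltW (zP _ _ lt1 (abs_ltN fx'))) ex.
    exists (C_cst X q); split=> //; rewrite -[C_cst X q x]/q.
    have -> : k x = f' p0 * w x + r2 * w x * o by rewrite -ho addrC subrK.
    rewrite [q * _]mulrC -hq; ring.
  have [b1 [B1 e1]] := key _ _ fx h1x; have [b2 [B2 e2]] := key _ _ gx h2x.
  have [q Oq hq] : abs_le (delta x) (e x).
    by apply: abs_le_trans ex; apply: abs_le_trans dx (abs_le_trans r2r1 r1a).
  exists b1; split=> //; exists b2; split=> //; exists (C_cst X q); split=> //.
  exists x; split=> // u; rewrite !inE => /or4P[]/eqP -> //.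
  by rewrite -[LHS]/(delta x - q * e x) hq mulrC subrr.
have [z zn zP] := abs_lt_add en.
have [z' zn' z'P] := abs_lt_dense zn.
have near_f := C_cont f p0 zn; have near_g := C_cont g p0 zn.
have [r rn rP] := sep.2 _ (nearby_and near_f near_g).
have [r1 rn1 [r1r r1z]] := abs_min2 rn zn'.
have [r2 rn2 [r2r1 r2e]] := abs_min2 rn1 en.
(* The constant function [r2] is taken for [e]: its bounded multiples stay within |r2|. *)
have [b1 [B1 [b2 [B2 [b3 [B3 [x [xp hx]]]]]]]] := hc (C_cst X r2) rn2.
have dx : delta x = r2 * b3 x.
  apply/eqP; rewrite mulrC -subr_eq0; apply/eqP.
  by apply: (hx (delta - b3 * C_cst X r2)); rewrite !inE eqxx !orbT.
have [fx gx] : abs_lt (f x - f p0) z /\ abs_lt (g x - g p0) z.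
  by apply: rP; apply: abs_le_trans (abs_le_trans r2r1 r1r); exists (b3 x).
have key (k f' b : C) : C_bounded b -> abs_lt (f' x - f' p0) z ->
    k x - (f' x + b x * r2) * w x = 0 -> abs_le (k x - f' p0 * w x) (eps * w x).
  move=> Bb fx' /eqP; rewrite subr_eq0 => /eqP ->.
  have -> : (f' x + b x * r2) * w x - f' p0 * w x =
    (f' x - f' p0 + b x * r2) * w x by ring.
  apply: abs_leM (abs_lexx _); apply/abs_ltW/zP => //.
  apply: abs_le_lt_trans z'P; apply: abs_le_trans (abs_le_trans r2r1 r1z).
  by exists (b x); rewrite // mulrC.
exists x; split=> //.
- by apply: hx; rewrite !inE eqxx.
- by apply: abs_le_trans r2e; exists (b3 x).
- apply: (key _ _ _ B1) => //.
  by apply: (hx (h1 - (f + b1 * C_cst X r2) * w)); rewrite !inE eqxx !orbT.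
- apply: (key _ _ _ B2) => //.
  by apply: (hx (h2 - (g + b2 * C_cst X r2) * w)); rewrite !inE eqxx !orbT.
Qed.

Lemma pdef_clus (h1 h2 w s f g : (nat -> C) -> C) :
  pfun MC h1 -> pfun MC h2 -> pfun MC w -> pfun MC s -> pfun MC f -> pfun MC g ->
  pdef MC (fun e => clus (h1 e) (h2 e) (w e) (s e) (f e p0) (g e p0)).
Proof.
move=> H1 H2 W S Ff G; apply: pdef_ext.
  by move=> e; symmetry; exact: clusP.
apply: pdef_all; apply: pdef_imp; first exact/pdef_neq0/pfun_var.
have Bd (k : nat) : pdef MC (fun e => C_bounded (e k)) := pdef_ringpred (pfun_var _ k).
do 3! (apply: pdef_ex; apply: pdef_and; first exact: Bd).
pose sh (e : nat -> C) k := e k.+4.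
apply: (pdef_common_zero (ts := [:: fun e => s (sh e);
  fun e => h1 (sh e) - (f (sh e) + e 2%N * e 3%N) * w (sh e);
  fun e => h2 (sh e) - (g (sh e) + e 1%N * e 3%N) * w (sh e);
  fun e => delta - e 0%N * e 3%N])).
have V k := pfun_var MC k.
have R t (ht : pfun MC t) : pfun MC (fun e => t (sh e)) := pfun_rename (fun k => k.+4) ht.
have N k : pfun MC (fun e => e k * e 3%N) by apply: (pfunM MCR).
do !split; first exact: R.
- apply: (pfunB MCR); first exact: R.
  by apply: (pfunM MCR); [apply: (pfunD MCR); [exact: R|exact: N]|exact: R].
- apply: (pfunB MCR); first exact: R.
  by apply: (pfunM MCR); [apply: (pfunD MCR); [exact: R|exact: N]|exact: R].
- by apply: (pfunB MCR); [exact: pfun_cst|exact: N].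
Qed.

Definition orbit_rel (a t o y x z : K) : Prop := exists h1 h2 w s : C,
  exists r, exists q, q != 0 /\
  ((forall c d, clus h1 h2 w s c d -> abs_le c r) /\
  ((forall c d c' d', clus h1 h2 w s c d -> clus h1 h2 w s c' d' ->
     c = c' \/ abs_le q (c - c')) /\
  (clus h1 h2 w s a 1 /\
  forall c d, clus h1 h2 w s c d ->
    (c = x /\ d = z) \/ clus h1 h2 w s (t * c + o) (y * d)))).

Lemma pdef_orbit_rel (a t o y x z : (nat -> C) -> C) :
  pfun MC a -> pfun MC t -> pfun MC o -> pfun MC y -> pfun MC x -> pfun MC z ->
  pdef MC (fun e => orbit_rel (a e p0) (t e p0) (o e p0) (y e p0) (x e p0) (z e p0)).
Proof.
move=> ha ht ho hy hx hz.
have V k := pfun_var MC k.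
have R n u (hu : pfun MC u) : pfun MC (fun e => u (fun k => e (n + k)%N)) :=
  pfun_rename (addn n) hu.
(* After these quantifiers the indices 0 to 5 are [q], [r], [s], [w], [h2], [h1]; the arguments are
   therefore shifted by 6, and by 8 under [c] and [d]. *)
do 4! apply: pdef_ex; do 2! apply: pdef_exK.
apply: pdef_and; first exact: pdef_neq0 (V 0%N).
apply: pdef_and.
  do 2! apply: pdef_allK; apply: pdef_imp; first by apply: pdef_clus; exact: V.
  exact: pdef_value_le (V _) (V _).
apply: pdef_and.
  do 4! apply: pdef_allK; do 2! (apply: pdef_imp; first by apply: pdef_clus; exact: V).
  apply: pdef_or; first exact: pdef_value_eq (V _) (V _).
  exact: pdef_value_le (V _) (pfunB MCR (V _) (V _)).
apply: pdef_and.
  apply: (pdef_clus (g := fun=> 1)) => //; first exact: (R 6%N).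
  exact: pfun_cst.
do 2! apply: pdef_allK; apply: pdef_imp; first by apply: pdef_clus; exact: V.
apply: pdef_or.
  by apply: pdef_and; apply: pdef_value_eq; first [exact: V|exact: (R 8%N)].
apply: (pdef_clus
  (f := fun e => t (fun k => e (8 + k)%N) * e 1%N + o (fun k => e (8 + k)%N))
  (g := fun e => y (fun k => e (8 + k)%N) * e 0%N)) => //.
  apply: (pfunD MCR); last exact: R.
  by apply: (pfunM MCR); first exact: R.
by apply: (pfunM MCR); first exact: R.
Qed.

End Clusters.

(** * Finiteness of the coded sets *)

Section OrbitSoundness.
Variables (K : expansion) (m : nat) (X : dset K m) (p0 : X) (delta : C_ring X).
Hypothesis sep : separating p0 delta.
Hypothesis closed_bounded_discrete_finite : forall S : set 'rV[K]_1,
  definable (exp_struct K) S -> K_closed S -> K_bounded S ->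
  K_discrete S -> finite_set S.

(** Two points of [S] close enough to the same [a] are closer than [q] to each other, hence equal.
    So at most one point [b] of [S] is near a given [a] outside [S], and a radius at most |b - a|
    avoids it. *)
Lemma separated_closed_discrete (S : set 'rV[K]_1) q : q != 0 ->
  (forall x y, S x -> S y -> x 0 0 = y 0 0 \/ abs_le q (x 0 0 - y 0 0)) ->
  K_closed S /\ K_discrete S.
Proof.
move=> qn hq.
have ext (x y : 'rV[K]_1) : x 0 0 = y 0 0 -> x = y.
  by move=> xy; apply/rowP => i; rewrite ord1.
split=> a Sa.
  have [eta an aP] := abs_lt_add qn.
  have [[b [Sb ba]]|H] := pselect (exists b, S b /\ abs_lt (b 0 0 - a 0 0) eta);
    last first.
    exists eta => // x /(_ 0); rewrite !mxE => xa Sx; apply: H; by exists x.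
  have bn : b 0 0 - a 0 0 != 0.
    by rewrite subr_eq0; apply/eqP => /ext e; apply: Sa; rewrite -e.
  have [r rn [ra rb]] := abs_min2 an bn.
  exists r => // x /(_ 0); rewrite !mxE => xr Sx.
  have := aP _ _ (abs_lt_le_trans xr ra) (abs_ltN ba).
  rewrite opprB addrA subrK => xb; have [/ext xbE|//] := hq _ _ Sx Sb.
  by apply: (abs_lt_le_trans xr rb); rewrite xbE; apply: abs_lexx.
split=> //; exists q => //; apply/seteqP; split=> x /=.
  by move=> [Sx /(_ 0)]; rewrite !mxE => h; case: (hq _ _ Sx Sa) => [/ext|].
by move=> ->; split=> // i; rewrite subrr mxE; apply: abs_lt0.
Qed.

(** If no pair of the orbit were (x, z), the last clause of [orbit_rel] would put every pair into
    the coded set, which would then have infinitely many first coordinates by injectivity. *)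
Lemma orbit_rel_sound (a t o y x z : K) :
  injective (fun n => iter n (fun c => t * c + o) a) ->
  orbit_rel p0 delta a t o y x z ->
  exists n, x = iter n (fun c => t * c + o) a /\ z = y ^+ n.
Proof.
move=> inj_iter [h1 [h2 [w [s [r [q [qn [hr [hq [ha hs]]]]]]]]]].
pose S := [set v : 'rV[K]_1 | exists d, clus p0 delta h1 h2 w s (v 0 0) d].
have hS u v : S u -> S v -> u 0 0 = v 0 0 \/ abs_le q (u 0 0 - v 0 0).
  by move=> [d hd] [d' hd']; apply: hq hd hd'.
have [Sclosed Sdiscrete] := separated_closed_discrete qn hS.
have Sfin : finite_set S.
  apply: closed_bounded_discrete_finite => //; first exact: definable_clus_proj.
  by exists r => v [d /hr ?] i; rewrite ord1.
apply: contrapT => H; apply: infinite_nat.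
pose it n := const_mx (iter n (fun c => t * c + o) a) : 'rV[K]_1.
have hit n : clus p0 delta h1 h2 w s (iter n (fun c => t * c + o) a) (y ^+ n).
  elim: n => [|n IH]; first by rewrite expr0.
  rewrite exprS; case: (hs _ _ IH) => // -[e1 e2].
  by case: H; exists n.
have it_inj : injective it.
  by move=> i j /rowP/(_ 0); rewrite !mxE; apply: inj_iter.
have : finite_set (it @^-1` S) by apply: finite_preimage => // i j _ _; apply: it_inj.
apply: sub_finite_set => n _; exists (y ^+ n); rewrite mxE; exact: hit.
Qed.

End OrbitSoundness.

(** * Coding finite sets with separated germs *)

Section PointwiseContinuity.
Variables (K : expansion) (m : nat) (X : set 'rV[K]_m).
Implicit Types (f g : X -> K) (x : X) (eps : K).

(** The function built in [C_extend] is continuous for different reasons at different points, which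
    calls for continuity at one point. *)
Definition cont_at f x := forall eps, eps != 0 ->
  nearby x (fun y => abs_lt (f y - f x) eps).

Lemma cont_at_mul f g x : cont_at f x -> cont_at g x ->
  cont_at (fun y => f y * g y) x.
Proof.
move=> cf cg eps /abs_lt_add[z zn zP]; have [z1 zn1 z1P] := abs_lt_add zn.
have [d dn dP] := abs_lt_mul (g x) zn; have [d' dn' d'P] := abs_lt_mul (f x) zn1.
have := nearby_and (nearby_and (cf _ dn) (cf _ (oner_neq0 K)))
  (nearby_and (cg _ dn') (cg _ zn1)).
apply: nearby_mono => y [[/dP f1 f2] [/d'P g1 g2]].
have -> : f y * g y - f x * g x = g x * (f y - f x) +
  (f x * (g y - g x) + (g y - g x) * (f y - f x)) by ring.
apply: zP => //; apply: z1P => //; apply: abs_le_lt_trans g2.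
by exists (f y - f x) => //; apply/abs_le1/abs_ltW.
Qed.

Lemma cont_at_eq f g x : nearby x (fun y => f y = g y) -> cont_at g x -> cont_at f x.
Proof.
move=> fg cg eps en; have := nearby_and fg (cg eps en).
by apply: nearby_mono => y [-> ]; rewrite (nearby_self fg).
Qed.

End PointwiseContinuity.

(** * Extension from a punctured neighborhood and coding *)

Section Germs.
Variables (K : expansion) (m : nat) (X : dset K m) (p0 : X) (delta : C_ring X).
Hypothesis sep : separating p0 delta.
Local Notation M := (exp_struct K).

Variable U : set 'rV[K]_m.
Hypothesis nbhdU : definable_nbhd X U (val p0).

Let defU : definable M U.
Proof. by case: nbhdU. Qed.

Definition punctured := U `\ (val p0).

Lemma definable_punctured : definable M punctured.
Proof.
apply: (pdef_definable 0).
apply: (@pdef_ext _ K M (fun e => U (rowe m e) /\ ~ forall i : 'I_m, e i = val p0 0 i)).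
  move=> e; split=> -[Ue h]; split=> // h'; apply: h.
    by move=> i; rewrite -h' mxE.
  by apply/rowP => i; rewrite mxE.
apply: pdef_and; first exact: definable_pdef.
apply: pdef_not.
by apply: pdef_forall => i; apply: pdef_eq; [exact: pfun_var|exact: pfun_cst].
Qed.

Definition punctured_dset : dset K m := DSet definable_punctured.

Local Notation V := punctured_dset.

Lemma V_X (u : V) : dset_set X (val u).
Proof. by case: nbhdU => _ UX _ _; apply: UX; case: (set_valP u). Qed.

(** The cutoff [W] is rho^2 - delta^2 where |delta| <= |rho| and 0 elsewhere. [rho] is so small that
    points near this sublevel set still have small [delta] and so lie in U. *)
Lemma bump_ex : exists (W : C_ring X) (rho : K), [/\ rho != 0,
  W p0 = rho ^+ 2,
  forall x, W x != 0 -> abs_le (delta x) rho &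
  forall x, abs_le (delta x) rho -> nearby x (fun y => U (val y))].
Proof.
case: nbhdU => _ _ _ [r rn rU].
have nU : nearby p0 (fun y => U (val y)).
  by exists r => // y yr; apply: rU; split=> //; exact: set_valP.
have [r1 rn1 r1P] := sep.2 _ nU.
have [r2 rn2 r2P] := abs_lt_add rn1.
have [rho rhon rho2] := abs_lt_dense rn2.
have [W WE] := C_sqr_cut (C_cst X rho) delta.
exists W, rho; split=> //.
- rewrite WE sep.1 /sqr_cut; case: pselect => [h /=|[]]; last exact: abs_le0.
  by rewrite expr0n /= subr0.
- by move=> x; rewrite WE /sqr_cut; case: pselect => h //=; rewrite eqxx.
- move=> x dx; have := C_cont delta x rn2.
  apply: nearby_mono => y dy; apply: r1P; apply: abs_ltW.
  rewrite -(subrK (delta x) (delta y)); apply: r2P => //.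
  exact: abs_le_lt_trans dx rho2.
Qed.

(** The product W delta g is continuous at [p0] because delta g tends to 0 there; at other points
    with |delta| <= |rho| because a whole neighborhood lies in the domain of [g]; and elsewhere
    because [W] vanishes nearby, |delta| > |rho| being an open condition. *)
Lemma C_extend (g : C_ring V) (W : C_ring X) rho :
  (forall x, W x != 0 -> abs_le (delta x) rho) ->
  (forall x, abs_le (delta x) rho -> nearby x (fun y => U (val y))) ->
  (forall eps, eps != 0 -> nearby p0 (fun x => forall u : V, val u = val x ->
     abs_lt (delta x * g u) eps)) ->
  exists h : C_ring X, h p0 = 0 /\
    forall (x : X) (u : V), val u = val x -> h x = W x * (delta x * g u).
Proof.
move=> hW hU hg.
pose h0 (x : X) : K := W x * (delta x * extz g (val x)).
have h0p : h0 p0 = 0 by rewrite /h0 sep.1 mul0r mulr0.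
have ch : continuous_on h0.
  move=> x; have [->|xp] := pselect (x = p0).
    apply: cont_at_mul (C_cont W p0) _ => eps en.
    have := hg eps en; apply: nearby_mono => y hy.
    rewrite sep.1 mul0r subr0; have [Vy|Vy] := pselect (dset_set V (val y)).
      by have [u uy] := in_set_ex Vy; rewrite -uy extz_val; apply: hy.
    by rewrite extz_out // mulr0; apply: abs_lt0.
  have [dx|dx] := pselect (abs_le (delta x) rho).
    have nV : nearby x (fun y => dset_set V (val y)).
      have := nearby_and (hU x dx) (nearby_neq xp); apply: nearby_mono => y [Uy yp].
      by split=> // /val_inj.
    apply: cont_at_mul (C_cont W x) _; apply: cont_at_mul (C_cont delta x) _ => eps en.
    have [u ux] := in_set_ex (nearby_self nV).
    have [d dn dP] := C_cont g u en.
    have nd : nearby x (fun y => norm_lt (val y - val x) d) by exists d.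
    have := nearby_and nV nd; apply: nearby_mono => y [/in_set_ex[v vy] yx].
    by rewrite -ux -vy !extz_val; apply: dP; rewrite ux vy.
  apply: (@cont_at_eq _ _ _ _ (fun=> 0)); last exact: continuous_cst.
  have [d dn dP] := abs_gt_open dx.
  have := C_cont delta x dn; apply: nearby_mono => y /dP ydx.
  have -> : h0 y = 0; last by [].
  rewrite /h0; have [->|/hW //] := eqVneq (W y) 0; exact: mul0r.
have [h hE] : exists h : C_ring X, forall x, h x = h0 x.
  apply: (C_intro (F := fun z => extz W z * (extz delta z * extz g z))) => //.
    have MR := @exp_ring_terms K.
    by apply: (pfunM MR); [exact: pfun_C|apply: (pfunM MR); exact: pfun_C].
  by move=> x; rewrite !extz_val.
exists h; split=> [|x u ux]; rewrite hE // /h0 -ux extz_val //.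
Qed.

Implicit Types (g h : C_ring V) (r eps : K).

(** Enough for delta g to tend to 0 at [p0], as [C_extend] asks, and stable under the sums and
    products used in the code. *)
Definition locally_bounded (g : C_ring V) := exists r : K,
  nearby p0 (fun x => forall u : V, val u = val x -> abs_le (g u) r).

Lemma locally_boundedD g h : locally_bounded g -> locally_bounded h ->
  locally_bounded (g + h).
Proof.
move=> [r hr] [r' hr']; have [q qP] := abs_le_add r r'; exists q.
apply: nearby_mono (nearby_and hr hr') => x [gx hx] u ux.
exact: qP (gx u ux) (hx u ux).
Qed.

Lemma locally_boundedM g h : locally_bounded g -> locally_bounded h ->
  locally_bounded (g * h).
Proof.
move=> [r hr] [r' hr']; exists (r * r').
apply: nearby_mono (nearby_and hr hr') => x [gx hx] u ux.
exact: abs_leM (gx u ux) (hx u ux).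
Qed.

Lemma bounded_locally_bounded g r : (forall u, abs_le (g u) r) ->
  locally_bounded g.
Proof. by move=> gr; exists r; exists 1 => [|y _ u _]; rewrite ?oner_neq0. Qed.

Lemma locally_bounded_small g : locally_bounded g -> forall eps, eps != 0 ->
  nearby p0 (fun x => forall u : V, val u = val x -> abs_lt (delta x * g u) eps).
Proof.
move=> [r hr] eps en; have [z zn zP] := abs_lt_mul r en.
have := nearby_and hr (nearby_zero (C_cont delta) sep.1 zn).
apply: nearby_mono => x [gx dx] u ux; apply: abs_le_lt_trans (zP _ dx).
by rewrite mulrC; apply: abs_leM (gx u ux) (abs_lexx _).
Qed.

Lemma p0_U : U (val p0).
Proof. by case: nbhdU. Qed.

Lemma C_restrict (s : U -> K) : cont_def s -> exists r : C_ring V,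
  locally_bounded r /\ forall (u : U) (v : V), val v = val u -> r v = s u.
Proof.
move=> [cs ds]; have [r rE] : exists r : C_ring V, forall v, r v = extz s (val v).
  apply: (C_intro (F := extz s)) => //; last exact: pfun_extz.
  move=> v eps en; have [u uv] : exists u : U, val u = val v.
    by apply: in_set_ex; case: (set_valP v).
  have [d dn dP] := cs u eps en; exists d => // v' v'v.
  have [u' u'v'] : exists u : U, val u = val v'.
    by apply: in_set_ex; case: (set_valP v').
  by rewrite -uv -u'v' !extz_val; apply: dP; rewrite uv u'v'.
exists r; split=> [|u v uv]; last by rewrite rE uv extz_val.
have [u0 u0p] := in_set_ex p0_U.
have [d dn dP] := cs u0 1 (oner_neq0 _).
have [q qP] := abs_le_add 1 (s u0); exists q, d => // x xp v vx.
have [u uv] : exists u : U, val u = val v by apply: in_set_ex; case: (set_valP v).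
rewrite rE -uv extz_val -(subrK (s u0) (s u)); apply: qP (abs_lexx _).
by apply/abs_ltW/dP; rewrite uv vx u0p.
Qed.

(** On the zeros of [s_ i] other than [p0], [D i] is 1 and the other [D j] are 0. With w = W delta,
    h1 and h2 equal to w times the sums of the a_i D_i and of the b_i D_i, and s equal to w times
    the product of the R_i, the quotients there are exactly a_i and b_i. *)
Lemma germ_code k (s_ : 'I_k -> U -> K) (a b : 'I_k -> K) : (1 < k)%N ->
  (forall i, cont_def (s_ i)) -> separated_germs (val p0) s_ ->
  exists h1 h2 w s : C_ring X, forall c d,
    clus p0 delta h1 h2 w s c d <-> exists i, c = a i /\ d = b i.
Proof.
move=> k1 cds [D0 hD [_ S_germ S_D D_bnd]].
have [W [rho [rhon Wp hW hU]]] := bump_ex.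
pose D i : C_ring V := @CFun K m V (D0 i) (asboolT (hD i)).
have /choice[R RE] := fun i => C_restrict (cds i).
have lbD i : locally_bounded (D i).
  by have [r hr] := D_bnd i; apply: (bounded_locally_bounded (r := r)) => u; exact: hr.
have comb (f : 'I_k -> K) : exists h : C_ring X, forall (x : X) (v : V) i,
    val v = val x -> R i v = 0 -> h x = f i * (W x * delta x).
  pose g := \sum_i C_cst V (f i) * D i.
  have lbg : locally_bounded g.
    apply: (big_ind locally_bounded) => [||i _]; last apply: locally_boundedM => //.
    - by apply: (bounded_locally_bounded (r := 0)) => u; exact: abs_lexx.
    - exact: locally_boundedD.
    - by apply: (bounded_locally_bounded (r := f i)) => u; exact: abs_lexx.
  have [h [_ hE]] := C_extend hW hU (locally_bounded_small lbg).
  exists h => x v i vx Ri; rewrite (hE _ _ vx).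
  suff -> : g v = f i by ring.
  have [Uv vp] : U (val v) /\ val v <> val p0 := set_valP v.
  have [u uv] := in_set_ex Uv.
  have Si : (zeros (s_ i) `\ val p0) (val v).
    by split=> //; exists u; rewrite //= -(proj2 (RE i) u v) // uv.
  rewrite /g (big_morph (fun g : C_ring V => g v) (fun _ _ => erefl) erefl).
  rewrite (bigD1 i) //= big1 => [|j ji].
    rewrite addr0 -[RHS]mulr1; congr (_ * _).
    (* Clause (S3) speaks of distinct indices only, so reading D_i = 1 on S_i takes a second index;
       [1 < k] provides it. *)
    have [j ij] : exists j, i != j.
      have k0 := ltnW k1.
      case: (eqVneq i (Ordinal k0)) => [->|]; last by exists (Ordinal k0).
      by exists (Ordinal k1).
    exact: (S_D i j ij v).1.
  rewrite -[LHS]/(f j * D0 j v); rewrite (S_D j i ji v).2 ?mulr0 //.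
have [h1 h1E] := comb a; have [h2 h2E] := comb b.
pose gs := \prod_i R i.
have lbs : locally_bounded gs.
  apply: (big_ind locally_bounded) => [||i _]; last by case: (RE i).
    by apply: (bounded_locally_bounded (r := 1)) => u; exact: abs_lexx.
  exact: locally_boundedM.
have [s [_ sE]] := C_extend hW hU (locally_bounded_small lbs).
have gsE v : gs v = \prod_i R i v.
  exact: (big_morph (fun g : C_ring V => g v) (fun _ _ => erefl) erefl).
exists h1, h2, (W * delta), s => c d; split=> [hc|[i [-> ->]] eps en].
  (* [e] is smaller than every nonzero a_i - c and b_i - d, so a difference of size at most |e| must
     vanish. *)
  have [e en eP] := abs_min_seq
    ([seq a i - c | i <- enum 'I_k] ++ [seq b i - d | i <- enum 'I_k]).
  have Wp0 : W p0 != 0 by rewrite Wp expf_neq0.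
  have [eta an nW] := nearby_ge (C_cont W) Wp0.
  have [r rn rP] := sep.2 _ nW.
  have [q qn [qr qe]] := abs_min2 rn en.
  have [x [xp sx dx h1x h2x]] := hc q qn.
  (* Close to [p0] the cutoff is nonzero, so [x] lies in the punctured neighborhood and the zero of
     [s] there is a zero of some [R i]. *)
  have Wx : W x != 0.
    apply/eqP => Wx; have := rP x (abs_le_trans dx qr).
    by rewrite Wx => /abs_lex0 e0; rewrite e0 eqxx in an.
  have [v vx] : exists v : V, val v = val x.
    apply: in_set_ex; split; last by move/val_inj.
    exact: (nearby_self (hU x (hW x Wx))).
  have dxn := (delta_neq0 sep x).1 xp.
  have wxn : (W * delta) x != 0 by exact: mulf_neq0.
  move: sx; rewrite (sE _ _ vx) gsE => /eqP.
  rewrite !mulf_eq0 (negPf Wx) (negPf dxn) /= => /prodf_eq0[i _ /eqP Ri].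
  exists i.
  have key (h : C_ring X) (f : 'I_k -> K) c' :
      (forall i, f i - c' != 0 -> abs_lt e (f i - c')) ->
      h x = f i * (W x * delta x) ->
      abs_le (h x - c' * (W * delta) x) (q * (W * delta) x) ->
      c' = f i.
    move=> he -> hle; apply/eqP; rewrite eq_sym -subr_eq0.
    apply: contrapT => /negP/he; apply.
    apply: abs_le_trans qe; apply/(abs_leMl _ _ wxn); rewrite ![(W * delta) x * _]mulrC.
    by move: hle; rewrite -mulrBl.
  split.
  - apply: (key h1) => //; last exact: h1E vx Ri.
    move=> j; apply: eP; rewrite mem_cat; apply/orP; left.
    by apply: (map_f (fun i => a i - c)); rewrite mem_enum.
  - apply: (key h2) => //; last exact: h2E vx Ri.
    move=> j; apply: eP; rewrite mem_cat; apply/orP; right.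
    by apply: (map_f (fun i => b i - d)); rewrite mem_enum.
have [dl dln dlP] := nearby_zero (C_cont delta) sep.1 en.
have [Zp niso] := S_germ i.
(* As [p0] is not isolated among the zeros of [s_ i], another zero lies within any given radius. *)
have [z [[u su uz] zb zp]] :
    exists z, [/\ zeros (s_ i) z, oball (val p0) dl z & z <> val p0].
  apply: contrapT => H; apply: niso; split=> //; exists dl => //.
  apply/seteqP; split=> z /=; last first.
    by move=> ->; split=> // j; rewrite subrr mxE; apply: abs_lt0.
  by move=> [h1' h2']; apply: contrapT => zp; apply: H; exists z.
have [v vz] : exists v : V, val v = z.
  by apply: in_set_ex; split=> //; rewrite -uz; apply: set_valP.
have [x xz] : exists x : X, val x = z by apply: in_set_ex; rewrite -vz; apply: V_X.
have vx : val v = val x by rewrite vz xz.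
have Ri : R i v = 0 by rewrite ((RE i).2 u) // vz.
exists x; split.
- by move=> xp; apply: zp; rewrite -xz xp.
- by rewrite (sE _ _ vx) gsE (bigD1 i) //= Ri mul0r !mulr0.
- by apply/abs_ltW/dlP; rewrite xz.
- by rewrite (h1E _ _ _ vx Ri) subrr; apply: abs_le0.
- by rewrite (h2E _ _ _ vx Ri) subrr; apply: abs_le0.
Qed.

End Germs.

(** * Definability of the integers *)

Section OrbitRelation.
Variables (K : expansion) (m : nat) (X : dset K m) (p0 : X) (delta : C_ring X).
Hypothesis sep : separating p0 delta.
Hypothesis closed_bounded_discrete_finite : forall S : set 'rV[K]_1,
  definable (exp_struct K) S -> K_closed S -> K_bounded S ->
  K_discrete S -> finite_set S.
Hypothesis germs : arbitrarily_many_germs X (val p0).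

(* With a single germ, (S3) says nothing about [delta_1]; hence at least two
   germs are used, and the last point of the orbit is repeated. *)
Lemma orbit_rel_complete (a t o y : K) n :
  orbit_rel p0 delta a t o y (iter n (fun c => t * c + o) a) (y ^+ n).
Proof.
have [U [s_ [nbhdU cds sg]]] := germs (ltn0Sn n.+1).
pose a_ (i : nat) := iter (minn i n) (fun c => t * c + o) a.
pose b_ (i : nat) := y ^+ minn i n.
have [h1 [h2 [w [s hE]]]] := germ_code (k := n.+2) sep nbhdU
  (fun i => a_ i) (fun i => b_ i) isT cds sg.
have [r hr] := abs_max_seq [seq a_ (i : 'I_n.+2) | i <- enum 'I_n.+2].
have [q qn hq] := abs_min_seq [seq a_ (i : 'I_n.+2) - a_ (j : 'I_n.+2) |
  i <- enum 'I_n.+2, j <- enum 'I_n.+2].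
exists h1, h2, w, s, r, q; split=> //; split; last split; last split.
- move=> c d /hE[i [-> _]]; apply: hr.
  by apply: (map_f (fun i : 'I_n.+2 => a_ i)); rewrite mem_enum.
- move=> c d c' d' /hE[i [-> _]] /hE[j [-> _]].
  have [|ne] := eqVneq (a_ i) (a_ j); [by left|right].
  apply/abs_ltW/hq; last by rewrite subr_eq0.
  by apply: (allpairs_f (fun i j : 'I_n.+2 => a_ i - a_ j)); rewrite mem_enum.
- by apply/hE; exists ord0; rewrite /a_ /b_ min0n expr0.
move=> c d /hE[i [-> ->]]; rewrite /a_ /b_.
have [lt_in|le_ni] := ltnP i n; last by left.
have lt_in2 : (i.+1 < n.+2)%N by rewrite !ltnS ltnW.
right; apply/hE; exists (Ordinal lt_in2); rewrite /a_ /b_ /=.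
by rewrite (minn_idPl lt_in) exprS.
Qed.

Lemma orbit_relP (a t o y x z : K) :
  injective (fun n => iter n (fun c => t * c + o) a) ->
  orbit_rel p0 delta a t o y x z <->
  exists n, x = iter n (fun c => t * c + o) a /\ z = y ^+ n.
Proof.
move=> inj_iter; split; first exact: orbit_rel_sound.
by move=> [n [-> ->]]; apply: orbit_rel_complete.
Qed.

Local Notation MC := (C_struct X).

Lemma definable1_pdef (S : set (C_ring X)) :
  pdef MC (fun e => S (e 0%N)) -> definable1 MC S.
Proof.
by move=> h; apply: (pdef_definable 0); apply: pdef_ext h => e; rewrite /= mxE.
Qed.

(** The natural numbers are the orbit of 0 under c -> c + 1, injective by characteristic 0, with
    second coordinate constantly 1; negative integers are reached through -f. *)
Lemma definable_int_values : ordered_case (@unit_ball K) ->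
  definable1 MC [set f : C_ring X | exists n : int, f p0 = n%:~R].
Proof.
move=> /ordered_ball[F [i _]].
have iterE n : iter n (fun c : K => 1 * c + 1) 0 = n%:R.
  by elim: n => //= n ->; rewrite mul1r -natr1.
have inj : injective (fun n => iter n (fun c : K => 1 * c + 1) 0).
  move=> j k /=; rewrite !iterE => /(congr1 i); rewrite !rmorph_nat => /eqP.
  by rewrite eqr_nat => /eqP.
apply: definable1_pdef.
apply: (@pdef_ext _ (C_ring X) MC (fun e => orbit_rel p0 delta 0 1 1 1 (e 0%N p0) 1 \/
   orbit_rel p0 delta 0 1 1 1 ((- e 0%N) p0) 1)).
  move=> e; rewrite /mkset !orbit_relP // -[(- e 0%N) p0]/(- e 0%N p0).
  split=> [[[n [-> _]]|[n [h _]]]|[[n|n] ->]].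
  - by exists n; rewrite iterE.
  - by exists (- n%:Z); rewrite mulrNz -[e 0%N p0]opprK h iterE.
  - by left; exists n; rewrite iterE expr1n.
  - by right; exists n.+1; rewrite iterE expr1n NegzE mulrNz opprK.
have MCR := @ringpred_ring_terms (C_ring X) (@C_bounded K m X).
have c0 (a : K) := pfun_cst MC (C_cst X a); have V := pfun_var MC 0.
apply: pdef_or.
  exact: (pdef_orbit_rel sep (c0 0) (c0 1) (c0 1) (c0 1) V (c0 1)).
exact: (pdef_orbit_rel sep (c0 0) (c0 1) (c0 1) (c0 1) (pfunN MCR V) (c0 1)).
Qed.

(** * Powers of tau and arithmetic of exponents *)

Variable tau : K.
Hypotheses (tau_neq0 : tau != 0) (tau_in : unit_ball tau)
  (tau_ninv : ~ unit_ball tau^-1).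

Lemma tau_expz_inj : injective (fun k : int => tau ^ k).
Proof.
move=> i j ij; apply: (can_inj (tau_expK tau_neq0 tau_in tau_ninv)).
exact: val_inj.
Qed.

(** The first coordinate records the exponent as a power of [tau] while the base [y] is free; for y
    = tau^k the result is tau^(n k), which makes multiplication of exponents definable. *)
Definition pow_rel (x y z : K) := orbit_rel p0 delta 1 tau 0 y x z.

Lemma pow_relP x y z :
  pow_rel x y z <-> exists n : nat, x = tau ^+ n /\ z = y ^+ n.
Proof.
have iterE n : iter n (fun c => tau * c + 0) 1 = tau ^+ n.
  by elim: n => [|n IH]; rewrite ?expr0 // iterS IH addr0 exprS.
rewrite /pow_rel orbit_relP; last first.
  by move=> i j; rewrite !iterE => /(@tau_expz_inj i j) [].
by split=> -[n [-> ->]]; exists n; rewrite iterE.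
Qed.

(** Orbits reach only natural exponents; negative ones come from inverting both [x] and [z]. *)
Definition zpow_rel (x y z : K) := pow_rel x y z \/
  exists x', exists z', x * x' = 1 /\ (z * z' = 1 /\ pow_rel x' y z').

Lemma mulr1_inv (x y : K) : x * y = 1 -> x = y^-1.
Proof.
move=> xy; have yn : y != 0.
  by apply/eqP => y0; move/eqP: xy; rewrite y0 mulr0 eq_sym oner_eq0.
by apply: (mulIf yn); rewrite xy mulVf.
Qed.

Lemma zpow_relP (x y z : K) : y != 0 ->
  zpow_rel x y z <-> exists k : int, x = tau ^ k /\ z = y ^ k.
Proof.
move=> yn; split=> [[/pow_relP[n [-> ->]]|[x' [z' [hx [hz /pow_relP[n [e1 e2]]]]]]]|].
- by exists n.
- exists (- n%:Z); rewrite -!exprnN -e1 -e2.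
  by split; apply: mulr1_inv.
move=> [[n|n] [-> ->]]; first by left; apply/pow_relP; exists n.
right; exists (tau ^+ n.+1), (y ^+ n.+1); rewrite NegzE -!exprnN !mulVf ?expf_neq0 //.
by do !split=> //; apply/pow_relP; exists n.+1.
Qed.

Lemma pdef_zpow_rel (x y z : (nat -> C_ring X) -> C_ring X) :
  pfun MC x -> pfun MC y -> pfun MC z ->
  pdef MC (fun e => zpow_rel (x e p0) (y e p0) (z e p0)).
Proof.
move=> hx hy hz; have c := pfun_cst MC; have V := pfun_var MC.
have MCR := @ringpred_ring_terms (C_ring X) (@C_bounded K m X).
have pow x' y' z' : pfun MC x' -> pfun MC y' -> pfun MC z' ->
    pdef MC (fun e => pow_rel (x' e p0) (y' e p0) (z' e p0)).
  move=> hx' hy' hz'.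
  exact: (pdef_orbit_rel sep (c (C_cst X 1)) (c (C_cst X tau)) (c (C_cst X 0))
    hy' hx' hz').
have R u (hu : pfun MC u) : pfun MC (fun e => u (fun k => e k.+2)) :=
  pfun_rename (fun k => k.+2) hu.
apply: pdef_or; first exact: pow.
apply: (pdef_exK (p0 := p0)); apply: (pdef_exK (p0 := p0)); cbv beta.
have eq1 u k : pfun MC u -> pdef MC (fun e => u e p0 * e k p0 = 1).
  move=> hu; exact: (pdef_value_eq sep (pfunM MCR hu (V k)) (c (C_cst X 1))).
apply: pdef_and; first exact: (eq1 _ 1%N (R _ hx)).
apply: pdef_and; first exact: (eq1 _ 0%N (R _ hz)).
exact: pow (V 1%N) (R _ hy) (V 0%N).
Qed.

(** With base 1 and result 1, [zpow_rel] only asks that its first argument be a power of [tau]. *)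
Lemma pdef_tauZ u : pfun MC u -> pdef MC (fun e => tauZ tau (u e p0)).
Proof.
move=> hu; have c1 := pfun_cst MC (C_cst X 1).
apply: pdef_ext (pdef_zpow_rel hu c1 c1) => e.
rewrite zpow_relP ?oner_neq0 //; split=> [[k [-> _]]|[k _ <-]]; first by exists k.
by exists k; rewrite exp1rz.
Qed.

Lemma set_type_ex (T : Type) (A : set T) x : A x -> exists u : A, val u = x.
Proof. by move=> Ax; exists (SigSub (mem_set Ax)). Qed.

Definition tuple_index k (i : 'I_k) : nat := mxvec_index i (0 : 'I_1).

(** Each clause of [interpretation] reduces to a condition [Q] on the functions themselves;
    membership in the domain is definable by [pdef_tauZ] and is added by conjunction. *)
Lemma definable_tuple_set k (R : ('I_k -> tau_dom tau p0) -> Prop)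
    (Q : ('I_k -> C_ring X) -> Prop) :
  (forall x, R x <-> Q (fun i => val (x i) 0 0)) ->
  pdef MC (fun e => Q (fun i => e (tuple_index i))) ->
  definable MC (tuple_set R).
Proof.
move=> RQ hQ; apply: (pdef_definable 0).
have hT : pdef MC (fun e => forall i : 'I_k, tauZ tau (e (tuple_index i) p0)).
  by apply: pdef_forall => i; apply: pdef_tauZ; exact: pfun_var.
apply: pdef_ext (pdef_and hT hQ) => e.
have vecE (i : 'I_k) : vec_mx (rowe (k * 1) e) i 0 = e (tuple_index i).
  by rewrite !mxE.
split=> [[hTe hQe]|[x Rx xE]].
  have /choice[x xE] : forall i : 'I_k, exists x : tau_dom tau p0,
      val x = const_mx (e (tuple_index i)).
    by move=> i; apply: set_type_ex; rewrite /tau_dom /= mxE.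
  exists x => [|i].
    apply/RQ; suff -> : (fun i => val (x i) 0 0) = (fun i => e (tuple_index i)) by [].
    by apply/funext => i; rewrite xE mxE.
  by rewrite xE; apply/rowP => j; rewrite ord1 !mxE.
have E : (fun i => val (x i) 0 0) = (fun i => e (tuple_index i)).
  by apply/funext => i; rewrite -xE mxE vecE.
split; last by rewrite -E; apply/RQ.
by move=> i; rewrite -[e _]/((fun i => e (tuple_index i)) i) -E; exact: (set_valP (x i)).
Qed.

Lemma tau_log_val (x : tauZ tau) : val x = tau ^ tau_log x.
Proof. by rewrite -{1}(tau_logK x). Qed.

Lemma tau_eval_interpretation :
  interpretation MC (tauZ_struct tau) (@tau_eval K m X tau p0).
Proof.
have V := pfun_var MC; have c := pfun_cst MC.
have MCR := @ringpred_ring_terms (C_ring X) (@C_bounded K m X).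
have valI (x y : tauZ tau) : x = y <-> val x = val y.
  by split=> [->//|/val_inj].
split.
- exact: (@definable1_pdef [set f | tauZ tau (f p0)] (pdef_tauZ (V 0%N))).
- move=> y; have [x xE] : exists x : tau_dom tau p0, val x = const_mx (C_cst X (val y)).
    by apply: set_type_ex; rewrite /tau_dom /= mxE; exact: set_valP.
  by exists x; apply/val_inj; rewrite /= xE mxE.
- apply: (definable_tuple_set (Q := fun x => x 0 p0 = x 1 p0)) => [x|].
    exact: valI.
  exact: (pdef_value_eq sep (V _) (V _)).
(* Along k -> tau^k, zero becomes 1, one becomes [tau], addition the product and opposite the
   inverse. *)
- case.
  + apply: (definable_tuple_set (Q := fun x => x ord0 p0 = 1)) => [x|].
      by rewrite valI /= expr0z; split.
    exact: (pdef_value_eq sep (V _) (c (C_cst X 1))).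
  + apply: (definable_tuple_set (Q := fun x => x ord0 p0 = tau)) => [x|].
      by rewrite valI /= expr1z; split.
    exact: (pdef_value_eq sep (V _) (c (C_cst X tau))).
  + apply: (definable_tuple_set (Q := fun x => x ord0 p0 =
        x (lift ord0 0) p0 * x (lift ord0 1) p0)) => [x|].
      by rewrite valI /= expfzDr // -!tau_log_val; split.
    exact: (pdef_value_eq sep (V _) (pfunM MCR (V _) (V _))).
  + apply: (definable_tuple_set (Q := fun x => x ord0 p0 *
        x (lift ord0 0) p0 = 1)) => [x|].
      rewrite valI /= -invr_expz -!tau_log_val /=.
      have xn : val (x (lift ord0 0)) 0 0 p0 != 0.
        by have [k _ <-] := set_valP (x (lift ord0 0)); apply: expfz_neq0.
      by split=> [->|/mulr1_inv//]; rewrite mulVf.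
    exact: (pdef_value_eq sep (pfunM MCR (V _) (V _)) (c (C_cst X 1))).
  (* With u = tau^k and v = tau^l, the product k l corresponds to v^k, which [zpow_rel] expresses;
     injectivity of the powers recovers k from u. *)
  + apply: (definable_tuple_set (Q := fun x => zpow_rel (x (lift ord0 0) p0)
        (x (lift ord0 1) p0) (x ord0 p0))) => [x|].
      set u := tau_eval (x (lift ord0 0)); set v := tau_eval (x (lift ord0 1)).
      rewrite -[val (x (lift ord0 0)) 0 0 p0]/(val u).
      rewrite -[val (x (lift ord0 1)) 0 0 p0]/(val v).
      rewrite zpow_relP; last by rewrite tau_log_val expfz_neq0.
      rewrite valI -[val (tau_exp _ _)]/(tau ^ (tau_log u * tau_log v)) mulrC.
      rewrite -exprz_exp -tau_log_val; split=> [|[k [uk]]].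
        by exists (tau_log u); rewrite -tau_log_val.
      by have -> : k = tau_log u; first by apply: tau_expz_inj; rewrite -uk tau_log_val.
    exact: (pdef_zpow_rel (V _) (V _) (V _)).
- by case.
Qed.

End OrbitRelation.

Theorem theoremA (K : expansion)
    (closed_bounded_discrete_finite : forall S : set 'rV[K]_1,
       definable (exp_struct K) S -> K_closed S -> K_bounded S ->
       K_discrete S -> finite_set S)
    (tau : K) (tau_neq0 : tau != 0) (tau_in : unit_ball tau)
    (tau_ninv : ~ unit_ball tau^-1)
    (m : nat) (X : dset K m) (p0 : X)
    (germs : arbitrarily_many_germs X (val p0)) :
  [/\ ordered_case (@unit_ball K) ->
        definable1 (C_struct X)
          [set f : C_ring X | exists n : int, f p0 = n%:~R],
      definable1 (C_struct X) [set f : C_ring X | tauZ tau (f p0)],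
      interpretation (C_struct X) (tauZ_struct tau) (@tau_eval K m X tau p0) &
      interpretable (C_struct X) (ring_struct int)].
Proof.
have [delta sep] := separating_ex p0.
have interp : interpretation (C_struct X) (tauZ_struct tau) (@tau_eval K m X tau p0).
  exact: (tau_eval_interpretation sep).
have [defD surj defE deff _] := interp.
split=> //.
  exact: (definable_int_values sep).
(* [tau_log] and [tau_exp] are inverse bijections, so composing with [tau_log] keeps the same
   definable sets and yields the ring of integers. *)
exists 1%N, (tau_dom tau p0), (@tau_log K tau \o @tau_eval K m X tau p0).
have logE x y : tau_log x = y <-> x = tau_exp tau y.
  by split=> [<-|->]; rewrite ?tau_logK ?(tau_expK tau_neq0).
split=> //.
- move=> k; have [x xE] := surj (tau_exp tau k); exists x.
  by rewrite /= xE (tau_expK tau_neq0).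
- congr (definable _ (tuple_set _)): defE; apply/funext => x /=.
  by apply/propext; split=> [->//|/(can_inj (@tau_logK _ _))].
- move=> f; congr (definable _ (tuple_set _)): (deff f); apply/funext => x /=.
  by apply/propext; rewrite logE.
Qed.
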